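(* Let $\sigma>0$, let $m=\exp_*\mathcal{N}(0,\sigma^2)$ be a $\log$-normal distribution, let $\lambda_{cr}=\lambda_{cr}(m)$ be the critical normalizing constant, and let $\overline{\mathbf{m}}$ be a non-atomic $\mathbf{\Phi}_{\lambda_{cr}}$-stationary random metric. Then $\overline{\mathbf{m}}$ is supported on connected spaces, i.e. $\overline{\mathbf{m}}$-almost surely the metric space $(\mathcal{X},d)$ is connected.
   Context: $\mathbf{R}_+=(0,+\infty)$. Figure eight-graph: $\Gamma$ has vertices $I,M,O$ and four oriented edges: $e_1,e_2$ from $I$ to $M$, and $e_3,e_4$ from $M$ to $O$. $\Gamma_0$ is a single edge from $I$ to $O$; $\Gamma_n$ (vertex set $V_n$) is obtained from $\Gamma_{n-1}$ by replacing each oriented edge $(x,y)$ by a copy of $\Gamma$, with $I$ at $x$ and $O$ at $y$. With $V_n\hookrightarrow V_{n+1}$, put $V_\infty=\bigcup_n V_n$. $V_\infty$ is obtained from four copies of itself by identifying the $I,O$ points of the $i$-th copy with the initial and final endpoint of $e_i$. $\mathbf{M}$ is the set of complete metric spaces $(\mathcal{X},d)$ that contain $V_\infty$ as a dense subset (determined by $d|_{V_\infty\times V_\infty}$), with the topology of pointwise convergence on $V_\infty\times V_\infty$. For $\lambda>0$, $\mathcal{R}_\lambda:\mathbf{M}^4\times\mathbf{R}_+\to\mathbf{M}$ sends $((\mathcal{X}_i,d_i)_{i=1}^4;\xi)$ to the space obtained by glueing the $\mathcal{X}_i$ in the figure-eight shape (points $I,O$ of $\mathcal{X}_i$ at the initial/final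 endpoint of $e_i$), with $\lambda\xi$ times the glued (shortest chain) metric. $\mathbf{\Phi}_\lambda[\mathbf{m}]=(\mathcal{R}_\lambda)_*(\mathbf{m}^{\otimes4}\otimes m)$ for Radon probability measures $\mathbf{m}$ on $\mathbf{M}$; a $\mathbf{\Phi}_\lambda$-stationary random metric is a Radon probability measure on $\mathbf{M}$ fixed by $\mathbf{\Phi}_\lambda$. Critical constant: let $R_\lambda(X_1,\dots,X_4;\xi)=\lambda\xi(\min(X_1,X_2)+\min(X_3,X_4))$. For $A\in\mathbf{R}_+$ and a probability measure $\mu$ on $[0,+\infty]$ let $\Phi_{A,\lambda}[\mu]$ be the law of $\min(R_\lambda(X_1,\dots,X_4;\xi),A)$, with $X_i$ i.i.d. of law $\mu$ and $\xi$ independent of law $m$. The iterates $\Phi_{A,\lambda}^n[\delta_\infty]$ are stochastically decreasing and converge weakly to a measure $\nu_{A,\lambda}$. Let $\Lambda=\{\lambda>0:\nu_{A,\lambda}\ne\delta_0\}$ (independent of $A$) and $\lambda_{cr}(m)=\inf\Lambda\in(0,\infty)$; for this value a non-atomic stationary random metric exists. *)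

(* Defs.v *)
From HB Require Import structures.
From mathcomp Require Import all_boot all_order all_algebra.
From mathcomp Require Import all_classical all_reals all_analysis.
From mathcomp Require Import measurable_realfun.

Set Implicit Arguments.
Unset Strict Implicit.
Unset Printing Implicit Defensive.

Import Order.TTheory GRing.Theory Num.Def Num.Theory.
Import numFieldNormedType.Exports.

Local Open Scope classical_set_scope.
Local Open Scope ring_scope.

Inductive edge := e1 | e2 | e3 | e4.

(** The edges of [Gamma_n] are the words [w] of length [n] over [edge], the
    first letter being that of the coarsest level.  [vM w] is the vertex [M] of
    the copy of [Gamma] which replaces the edge [w] in the passage from
    [Gamma_(size w)] to [Gamma_(size w).+1].  Hence [vertex] is [V_oo], and
    [V_n] consists of [vI], [vO] and the [vM w] with [size w < n].  The three
    vertices of [Gamma = Gamma_1] are [vI], [vM [::]] and [vO]. *)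
Inductive vertex := vI | vO | vM of seq edge.

Definition esrc (e : edge) : vertex :=
  match e with e1 | e2 => vI | e3 | e4 => vM [::] end.

Definition etgt (e : edge) : vertex :=
  match e with e1 | e2 => vM [::] | e3 | e4 => vO end.

(** The embedding of the [e]-th of the four copies of [V_oo] in [V_oo]. *)
Definition copy (e : edge) (x : vertex) : vertex :=
  match x with vI => esrc e | vO => etgt e | vM w => vM (e :: w) end.

(** Initial and final vertices of the edge [w] of [Gamma_(size w)]. *)
Fixpoint ends (w : seq edge) : vertex * vertex :=
  if w is e :: w' then (copy e (ends w').1, copy e (ends w').2) else (vI, vO).

Lemma ends_rcons w e :
  ends (rcons w e) = match e with
                     | e1 | e2 => ((ends w).1, vM w)
                     | e3 | e4 => (vM w, (ends w).2)
                     end.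
Proof. by elim: w => [|f w /= ->]; case: e. Qed.

Lemma copy_surj x : exists e a, copy e a = x.
Proof.
case: x => [||[|e w]]; first by exists e1, vI.
- by exists e3, vO.
- by exists e1, vO.
- by exists e, (vM w).
Qed.

Lemma copy_inj e : injective (copy e).
Proof. by case: e => -[||u] [||v] //= [->]. Qed.

Lemma copy_eq e f a b : copy e a = copy f b ->
  (e = f /\ a = b) \/ ((a = vI \/ a = vO) /\ (b = vI \/ b = vO)).
Proof.
case: e; case: f; case: a => [||u]; case: b => [||v] //=;
  first [by move=> _; left | by move=> [->]; left
        | by move=> _; right; split; first [left; reflexivity | right]].
Qed.

HB.instance Definition _ := gen_eqMixin vertex.
HB.instance Definition _ := gen_choiceMixin vertex.

Record Rplus (R : realType) := MkRplus { rval : R; rval_gt0 : 0 < rval }.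

HB.instance Definition _ (R : realType) := [isSub for @rval R].
HB.instance Definition _ (R : realType) := [Choice of Rplus R by <:].
HB.instance Definition _ (R : realType) :=
  isPointed.Build (Rplus R) (MkRplus ltr01).
HB.instance Definition _ (R : realType) :=
  Measurable.copy (Rplus R) (g_sigma_algebra_preimageType (@rval R)).

Lemma measurable_rval (R : realType) : measurable_fun [set: Rplus R] (@rval R).
Proof.
by move=> _ B mB; exists B.
Qed.

(** A complete metric space containing [V_oo] as a dense subset is represented
    by the restriction of its distance to [V_oo]; see [is_completion]. *)
Record vmetric (R : realType) := MkVMetric {
  vdist :> vertex -> vertex -> R ;
  vdistxx : forall x, vdist x x = 0 ;
  vdist_gt0 : forall x y, x <> y -> 0 < vdist x y ;
  vdistC : forall x y, vdist x y = vdist y x ;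
  vdist_triangle : forall x y z, vdist x z <= vdist x y + vdist y z }.

Section vmetric_structures.
Context {R : realType}.

Let disc (x y : vertex) : R := (x != y)%:R.
Let discxx x : disc x x = 0. Proof. by rewrite /disc eqxx. Qed.
Let disc_gt0 x y : x <> y -> 0 < disc x y.
Proof. by move=> /eqP; rewrite /disc => ->. Qed.
Let discC x y : disc x y = disc y x. Proof. by rewrite /disc eq_sym. Qed.
Let disc_triangle x y z : disc x z <= disc x y + disc y z.
Proof.
rewrite /disc -natrD ler_nat; case: (x =P y) => [->|_]; first by rewrite add0n.
by rewrite (leq_trans (leq_b1 _)).
Qed.

HB.instance Definition _ := gen_eqMixin (vmetric R).
HB.instance Definition _ := gen_choiceMixin (vmetric R).
HB.instance Definition _ := isPointed.Build (vmetric R)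
  (MkVMetric discxx disc_gt0 discC disc_triangle).

End vmetric_structures.

HB.instance Definition _ (R : realType) := Topological.copy (vmetric R)
  (initial_topology (fun d : vmetric R =>
     (fun p => d p.1 p.2) : {ptws (vertex * vertex) -> R})).

HB.instance Definition _ (R : realType) := Measurable.copy (vmetric R)
  (g_sigma_algebraType (@open (vmetric R))).

(** [chain d x y l]: there is a chain of total length [l] from [x] to [y], each
    step of which joins two points of one of the four glued pieces. *)
Inductive chain (R : realType) (d : edge -> vmetric R) :
    vertex -> vertex -> R -> Prop :=
  | chain_nil x : chain d x x 0
  | chain_cons e a b y l : chain d (copy e b) y l ->
      chain d (copy e a) y (d e a b + l).

Definition glue_dist (R : realType) (d : edge -> vmetric R) (x y : vertex) : R :=
  inf [set l | chain d x y l].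

Section glue_metric.
Context {R : realType} (d : edge -> vmetric R).

Lemma vdist_ge0 (d0 : vmetric R) x y : 0 <= d0 x y.
Proof.
have [->|xy] := pselect (x = y); first by rewrite vdistxx.
exact/ltW/vdist_gt0.
Qed.

Let chain_ge0 x y l : chain d x y l -> 0 <= l.
Proof. by elim=> // e a b z k _ k0; rewrite addr_ge0 ?vdist_ge0. Qed.

Let chain_cat x y z k l : chain d x y k -> chain d y z l -> chain d x z (k + l).
Proof.
move=> xy yz; elim: xy yz => [t|e a b t h _ IH /IH]; first by rewrite add0r.
by rewrite -addrA; exact: chain_cons.
Qed.

Let chain1 e a b : chain d (copy e a) (copy e b) (d e a b).
Proof. by rewrite -[d e a b]addr0; apply: chain_cons; exact: chain_nil. Qed.

Let chain_sym x y l : chain d x y l -> chain d y x l.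
Proof.
elim=> [z|e a b z k _ IH]; first exact: chain_nil.
by rewrite addrC; apply: chain_cat IH _; rewrite vdistC; exact: chain1.
Qed.

Let chain_ex x y : exists l, chain d x y l.
Proof.
have toI z : exists l, chain d z vI l.
  have [e [a <-]] := copy_surj z.
  have e1I : chain d (copy e1 vO) vI (d e1 vO vI) by exact: (chain1 e1 vO vI).
  case: e.
  - by exists (d e1 a vI); exact: (chain1 e1 a vI).
  - by exists (d e2 a vI); exact: (chain1 e2 a vI).
  - by exists (d e3 a vI + d e1 vO vI); exact: chain_cat (chain1 e3 a vI) e1I.
  - by exists (d e4 a vI + d e1 vO vI); exact: chain_cat (chain1 e4 a vI) e1I.
have [k xI] := toI x; have [l yI] := toI y.
by exists (k + l); exact: chain_cat xI (chain_sym yI).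
Qed.

Let chain_set0 x y : [set l | chain d x y l] !=set0.
Proof. by have [l] := chain_ex x y; exists l. Qed.

Let chain_inf x y : has_inf [set l | chain d x y l].
Proof. by split; [exact: chain_set0|exists 0 => l; exact: chain_ge0]. Qed.

Let glue_le x y l : chain d x y l -> glue_dist d x y <= l.
Proof. by move=> xyl; apply: ge_inf => //; case: (chain_inf x y). Qed.

Lemma glue_distxx x : glue_dist d x x = 0.
Proof.
apply/eqP; rewrite eq_le glue_le/=; last exact: chain_nil.
by apply: lb_le_inf (chain_set0 _ _) _ => l; exact: chain_ge0.
Qed.

Lemma glue_distC x y : glue_dist d x y = glue_dist d y x.
Proof.
by congr inf; apply/seteqP; split=> l; exact: chain_sym.
Qed.

Lemma glue_dist_triangle x y z :
  glue_dist d x z <= glue_dist d x y + glue_dist d y z.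
Proof.
rewrite -lerBlDr; apply: lb_le_inf (chain_set0 _ _) _ => k /= xy.
rewrite lerBlDr addrC -lerBlDr; apply: lb_le_inf (chain_set0 _ _) _ => l /= yz.
by rewrite lerBlDr addrC; apply: glue_le; exact: chain_cat xy yz.
Qed.

(* [gap e b] is [d e a b], where [copy e a = x], truncated at [c]; it is [c]
   at all points of the pieces which do not contain [x]. *)
Section positivity.
Variables (x : vertex) (c : R).
Hypothesis c_gt0 : 0 < c.
Hypothesis cI : forall e a, copy e a = x -> a <> vI -> c <= d e a vI.
Hypothesis cO : forall e a, copy e a = x -> a <> vO -> c <= d e a vO.

Let gap e b : R :=
  if pselect (exists a, copy e a = x) is left h then minr c (d e (sval (cid h)) b)
  else c.

Let gapE e a b : copy e a = x -> gap e b = minr c (d e a b).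
Proof.
move=> ax; rewrite /gap; case: pselect => [h|[]]; last by exists a.
by case: cid => /= a' a'x; rewrite (@copy_inj e a a')// ax a'x.
Qed.

Let gapN e b : ~ (exists a, copy e a = x) -> gap e b = c.
Proof. by rewrite /gap; case: pselect. Qed.

Let gap_end e b : b = vI \/ b = vO ->
  gap e b = if pselect (copy e b = x) is left _ then 0 else c.
Proof.
move=> bIO; case: pselect => [bx|bx].
  by rewrite (gapE _ bx) vdistxx; apply/min_idPr/ltW.
have [[a ax]|/gapN//] := pselect (exists a, copy e a = x).
have ab : a <> b by move=> ab; apply: bx; rewrite -ab.
rewrite (gapE _ ax); apply/min_idPl.
by case: bIO ab => ->; [exact: cI|exact: cO].
Qed.

Let gap_copy e f a b : copy e a = copy f b -> gap e a = gap f b.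
Proof.
move=> ab; have [[-> ->]//|[aIO bIO]] := copy_eq ab.
by rewrite !gap_end// ab.
Qed.

Let gap_lip e a b : gap e b <= gap e a + d e a b.
Proof.
have [[a' a'x]|h] := pselect (exists a', copy e a' = x); last first.
  by rewrite !gapN// lerDl vdist_ge0.
rewrite !(gapE _ a'x) addr_minl le_min !ge_min lerDl vdist_ge0/=.
by rewrite vdist_triangle orbT.
Qed.

Let gap_chain z y l : chain d z y l -> forall e a f b,
  copy e a = z -> copy f b = y -> gap f b <= gap e a + l.
Proof.
elim=> [t e a f b eat fbt|e' a' b' t k _ IH e a f b eat fbt].
  by rewrite addr0 (@gap_copy e f a b)// eat fbt.
rewrite (gap_copy eat) (le_trans (IH _ _ _ _ erefl fbt))//.
by rewrite addrA lerD2r gap_lip.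
Qed.

Lemma glue_dist_gt0_gap y : x <> y -> 0 < glue_dist d x y.
Proof.
move=> xy; have [e [a ax]] := copy_surj x; have [f [b yb]] := copy_surj y.
have gea : gap e a = 0 by rewrite (gapE _ ax) vdistxx; apply/min_idPr/ltW.
apply: (@lt_le_trans _ _ (gap f b)); last first.
  apply: lb_le_inf (chain_set0 _ _) _ => l /= xyl.
  by rewrite -[l]add0r -gea; exact: gap_chain xyl _ _ _ _ ax yb.
have [[a' a'x]|/gapN->//] := pselect (exists a', copy f a' = x).
rewrite (gapE _ a'x) lt_min c_gt0/=; apply: vdist_gt0 => a'b.
by apply: xy; rewrite -a'x -yb a'b.
Qed.

End positivity.

Lemma glue_dist_gt0 x y : x <> y -> 0 < glue_dist d x y.
Proof.
have gap e : exists2 c : R, 0 < c & forall a, copy e a = x ->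
    (a <> vI -> c <= d e a vI) /\ (a <> vO -> c <= d e a vO).
  have [[a ax]|h] := pselect (exists a, copy e a = x); last first.
    by exists 1 => // a ax; case: h; exists a.
  have pos b : exists2 c : R, 0 < c & a <> b -> c <= d e a b.
    have [->|ab] := pselect (a = b); first by exists 1.
    by exists (d e a b) => //; exact: vdist_gt0.
  have [c c0 cI] := pos vI; have [k k0 kO] := pos vO.
  exists (minr c k) => [|a' a'x]; first by rewrite lt_min c0.
  have -> : a' = a by apply: (@copy_inj e); rewrite ax a'x.
  by split=> [/cI|/kO] h; rewrite ge_min h ?orbT.
have [c1 c10 h1] := gap e1; have [c2 c20 h2] := gap e2.
have [c3 c30 h3] := gap e3; have [c4 c40 h4] := gap e4.
apply: (@glue_dist_gt0_gap x (minr (minr c1 c2) (minr c3 c4))).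
- by rewrite !lt_min c10 c20 c30 c40.
- by case=> a ax aI; rewrite !ge_min;
     [have [->]//:= h1 _ ax|have [->]//:= h2 _ ax
     |have [->]//:= h3 _ ax|have [->]//:= h4 _ ax]; rewrite ?orbT.
- by case=> a ax aO; rewrite !ge_min;
     [have [_ ->]//:= h1 _ ax|have [_ ->]//:= h2 _ ax
     |have [_ ->]//:= h3 _ ax|have [_ ->]//:= h4 _ ax]; rewrite ?orbT.
Qed.

Section rescaled.
Variables lam xi : Rplus R.

Let glue (x y : vertex) : R := rval lam * rval xi * glue_dist d x y.
Let lamxi : 0 < rval lam * rval xi. Proof. by rewrite mulr_gt0 ?rval_gt0. Qed.
Let gluexx x : glue x x = 0. Proof. by rewrite /glue glue_distxx mulr0. Qed.
Let glue_gt0 x y : x <> y -> 0 < glue x y.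
Proof. by move=> xy; rewrite mulr_gt0// glue_dist_gt0. Qed.
Let glueC x y : glue x y = glue y x. Proof. by rewrite /glue glue_distC. Qed.
Let glue_triangle x y z : glue x z <= glue x y + glue y z.
Proof. by rewrite -mulrDr ler_pM2l// glue_dist_triangle. Qed.

Definition glue_vmetric : vmetric R :=
  MkVMetric gluexx glue_gt0 glueC glue_triangle.

End rescaled.

End glue_metric.

(** [X] is a complete metric space in which [V_oo], with the metric [d], is
    embedded isometrically as a dense subset. *)
Record is_completion (R : realType) (d : vmetric R) (X : metricType R)
    (iota : vertex -> X) : Prop := IsCompletion {
  completion_cvg :
    forall F : set_system X, ProperFilter F -> cauchy F -> exists p : X, F --> p ;
  completion_isometry : forall x y, mdist (iota x) (iota y) = d x y ;
  completion_dense : dense (range iota) }.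

Definition connected_completion (R : realType) (d : vmetric R) : Prop :=
  forall (X : metricType R) (iota : vertex -> X),
    is_completion d iota -> connected [set: X].

(** Every [d] has a completion ([completion_exists] below): one encodes a point
    [p] of it by the function [x |-> dist p x] on [V_oo]. *)
Record katetov (R : realType) (d : vmetric R) := MkKatetov {
  kfun : vertex -> R ;
  kfun_lip : forall x y, kfun x <= kfun y + d x y ;
  kfun_ge : forall x y, d x y <= kfun x + kfun y ;
  kfun_inf : forall e, 0 < e -> exists x, kfun x < e }.

Section katetov_metric.
Context {R : realType} (d : vmetric R).
Local Notation K := (katetov d).
Implicit Types f g h : K.

HB.instance Definition _ := gen_eqMixin K.
HB.instance Definition _ := gen_choiceMixin K.

Let kfun_ge0 f x : 0 <= kfun f x.
Proof. by have := kfun_ge f x x; rewrite vdistxx -mulr2n pmulrn_lge0. Qed.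

Let kdist f g : R := inf (range (fun x => kfun f x + kfun g x)).

Let kdist_le f g x : kdist f g <= kfun f x + kfun g x.
Proof.
apply: ge_inf; last by exists x.
by exists 0 => _ [y _ <-]; rewrite addr_ge0 ?kfun_ge0.
Qed.

Let le_kdist f g r : (forall x, r <= kfun f x + kfun g x) -> r <= kdist f g.
Proof.
by move=> H; apply: lb_le_inf => [|_ [x _ <-]//]; eexists; exists vI.
Qed.

Let kdistxx f : kdist f f = 0.
Proof.
apply/eqP; rewrite eq_le le_kdist ?andbT; last first.
  by move=> x; rewrite addr_ge0 ?kfun_ge0.
apply/ler_addgt0Pl => e e0; rewrite addr0.
have [|x xe] := @kfun_inf _ _ f (e / 2); first by rewrite divr_gt0.
by rewrite (le_trans (kdist_le f f x))// [leRHS]splitr lerD// ltW.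
Qed.

Let kdist_lip f g x : kfun f x <= kdist f g + kfun g x.
Proof.
rewrite -lerBlDr; apply: le_kdist => y; rewrite lerBlDr.
by rewrite (le_trans (kfun_lip f x y))// -addrA lerD2l vdistC kfun_ge.
Qed.

Let kdistC f g : kdist f g = kdist g f.
Proof.
by congr inf; apply: eq_imagel => x _; rewrite addrC.
Qed.

Let kdist_eq0 f g : kdist f g = 0 -> f = g.
Proof.
move=> fg; have : kfun f = kfun g.
  apply/funext => x; apply/eqP; rewrite eq_le.
  have := kdist_lip f g x; have := kdist_lip g f x.
  by rewrite [kdist g f]kdistC fg !add0r => -> ->.
case: f g {fg} => [u a b c] [v a' b' c'] /= uv; subst v.
by congr MkKatetov; exact: Prop_irrelevance.
Qed.

Let kdist_triangle f g h : kdist g h <= kdist g f + kdist f h.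
Proof.
rewrite -lerBlDl; apply: le_kdist => x; rewrite lerBlDl.
by rewrite (le_trans (kdist_le g h x))// addrA lerD2r kdist_lip.
Qed.

HB.instance Definition _ :=
  isMetric.Build R K kdistxx kdist_eq0 kdistC kdist_triangle.

Definition kiota (x : vertex) : K.
Proof.
exists (d x) => [y z|y z|e e0].
- by rewrite [d y z]vdistC vdist_triangle.
- by rewrite [d x y]vdistC vdist_triangle.
- by exists x; rewrite vdistxx.
Defined.

Let kdist_iota f x : mdist f (kiota x) = kfun f x.
Proof.
apply/eqP; rewrite eq_le; apply/andP; split.
  by rewrite (le_trans (kdist_le f (kiota x) x))//= vdistxx addr0.
by apply: le_kdist => y /=; exact: kfun_lip.
Qed.

Let kcomplete (F : set_system K) : ProperFilter F -> cauchy F ->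
  exists f : K, F --> f.
Proof.
move=> FF /cauchyP Fc.
have near0 e : 0 < e -> exists x, F [set f : K | kfun f x < e].
  move=> e0; have e20 : 0 < e / 2 by rewrite divr_gt0.
  have [p Fp] := Fc _ e20; have [x px] := kfun_inf p e20.
  exists x; apply: filterS Fp => f; rewrite ballEmdist/= => pf.
  rewrite (le_lt_trans (kdist_lip f p x))// [ltRHS]splitr ltrD//.
  by rewrite kdistC.
have cvgk x : cvg ((fun f : K => kfun f x) @ F).
  apply: cauchy_cvg; apply: cauchy_exP => e e0; have [p Fp] := Fc _ e0.
  rewrite ballEmdist in Fp.
  exists (kfun p x); rewrite /fmap/=; apply: filterS Fp => f /= pf.
  rewrite /ball/= ltr_distlC; apply/andP; split.
    rewrite ltrBlDr (le_lt_trans (kdist_lip p f x))// addrC ltrD2l//.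
  by rewrite (le_lt_trans (kdist_lip f p x))// addrC ltrD2l kdistC.
pose u x := lim ((fun f : K => kfun f x) @ F).
have cu x : kfun f x @[f --> F] --> u x by exact: cvgk.
have u_lip x y : u x <= u y + d x y.
  apply: (ler_cvg_to (cu x) (cvgD (cu y) (cvg_cst (d x y)))).
  by near=> f; exact: kfun_lip.
have u_ge x y : d x y <= u x + u y.
  apply: (ler_cvg_to (cvg_cst (d x y)) (cvgD (cu x) (cu y))).
  by near=> f; exact: kfun_ge.
have u_near e x : F [set f : K | kfun f x < e] -> u x <= e.
  by move=> Fx; apply: (ler_cvg_to (cu x) (cvg_cst e)); near=> f; apply: ltW;
    near: f.
have u_inf e : 0 < e -> exists x, u x < e.
  move=> e0; have e20 : 0 < e / 2 by rewrite divr_gt0.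
  have [x Fx] := near0 _ e20; exists x.
  by rewrite (le_lt_trans (u_near _ _ Fx))// [ltRHS]splitr ltrDl.
exists (MkKatetov u_lip u_ge u_inf).
apply/cvg_ballP => e e0; have e20 : 0 < e / 2 by rewrite divr_gt0.
have [x Fx] := near0 _ e20; apply: filterS (Fx) => f /= fx.
rewrite ballEmdist/=; apply: le_lt_trans (kdist_le _ f x) _ => /=.
by rewrite [ltRHS]splitr ler_ltD// u_near.
Unshelve. all: by end_near. Qed.

Lemma completion_exists : exists (X : metricType R) (iota : vertex -> X),
  is_completion d iota.
Proof.
exists K, kiota; split; first exact: kcomplete.
- by move=> x y; rewrite kdist_iota.
- move=> U [f Uf] oU; have := open_nbhs_nbhs (conj oU Uf).
  rewrite -nbhs_ballE => -[e /= e0 fU].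
  have [x fx] := kfun_inf f e0.
  by exists (kiota x); split; [apply: fU; rewrite ballEmdist/= kdist_iota|exists x].
Qed.

End katetov_metric.

(** Law of [(X_1, ..., X_4; xi)], with independent components, the [X_i] of
    law [P] and [xi] of law [m]. *)
Definition law5 d (T : measurableType d) (R : realType)
    (P : probability T R) (m : probability (Rplus R) R) :
    probability (((T * T) * (T * T)) * Rplus R)%type R :=
  (((P \x P) \x (P \x P)) \x m)%E.

Definition glue_map (R : realType) (lam : Rplus R)
    (x : ((vmetric R * vmetric R) * (vmetric R * vmetric R)) * Rplus R) :
    vmetric R :=
  let: (((d1, d2), (d3, d4)), xi) := x in
  glue_vmetric
    (fun e => match e with e1 => d1 | e2 => d2 | e3 => d3 | e4 => d4 end)
    lam xi.

Definition PhiM (R : realType) (lam : Rplus R) (m : probability (Rplus R) R)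
    (P : probability (vmetric R) R) : set (vmetric R) -> \bar R :=
  pushforward (law5 P m) (glue_map lam).

Definition stationary (R : realType) (lam : Rplus R)
    (m : probability (Rplus R) R) (P : probability (vmetric R) R) : Prop :=
  forall B, measurable B -> PhiM lam m P B = P B.

(** Inner regularity; local finiteness is automatic for a probability. *)
Definition radon (R : realType)
    (P : probability (vmetric R) R) : Prop :=
  forall B, measurable B ->
  P B = ereal_sup [set P K | K in [set K | compact K /\ K `<=` B]].

Section scalar.
Context {R : realType}.
Implicit Types (m : probability (Rplus R) R) (lam A : R).
Local Open Scope ereal_scope.

(** Laws on [[0, +oo]] are viewed as laws on [\bar R]; the iterates below,
    which start from the Dirac mass at [+oo], are carried by [[0, +oo]].  On a
    nonnegative [x], the factor [lam * xi] being positive, no product [0 * +oo]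
    occurs. *)
Definition series_parallel lam
    (x : ((\bar R * \bar R) * (\bar R * \bar R)) * Rplus R) : \bar R :=
  let: (((x1, x2), (x3, x4)), xi) := x in
  (lam * rval xi)%:E * (mine x1 x2 + mine x3 x4).

Definition cutoff A lam x : \bar R := mine (series_parallel lam x) A%:E.

Lemma measurable_cutoff A lam : measurable_fun setT (cutoff A lam).
Proof.
pose f (x : ((\bar R * \bar R) * (\bar R * \bar R)) * Rplus R) := 
  mine ((lam * rval x.2)%:E *
    (mine x.1.1.1 x.1.1.2 + mine x.1.2.1 x.1.2.2)) A%:E.
rewrite (_ : cutoff A lam = f); last first.
  by apply/funext => -[[[x1 x2] [x3 x4]] xi].
apply: measurable_mine => //; apply: emeasurable_funM.
  apply/measurable_EFinP; apply: measurable_funM => //.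
  by apply: measurableT_comp => //; exact: measurable_rval.
apply: emeasurable_funD; apply: measurable_mine.
all: by repeat (apply: measurableT_comp => //).
Qed.

HB.instance Definition _ A lam :=
  isMeasurableFun.Build _ _ _ _ (cutoff A lam) (measurable_cutoff A lam).

Definition Phi A lam m (mu : probability (\bar R) R) : probability (\bar R) R :=
  distribution (law5 mu m) (cutoff A lam).

(** As [\bar R] is compact, the continuous test functions are bounded. *)
Definition weakly_converges (mu : (probability (\bar R) R)^nat)
    (nu : probability (\bar R) R) : Prop :=
  forall f : \bar R -> R, continuous f ->
  \int[mu n]_x (f x)%:E @[n --> \oo] --> \int[nu]_x (f x)%:E.

(** The weak limit [nu] exists and is unique for all [A, lam > 0]. *)
Definition Lambda A m : set R := [set lam | (0 < lam)%R /\
  exists2 nu : probability (\bar R) R,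
    weakly_converges (fun n => iter n (Phi A lam m) \d_(+oo)) nu &
    ~ (forall B, measurable B -> nu B = \d_(0%E) B)].

Definition critical_constant A m : R := inf (Lambda A m).

End scalar.

Section lognormal.
Context {R : realType}.

Definition expRplus (x : measurableTypeR R) : Rplus R := MkRplus (expR_gt0 x).

Lemma measurable_expRplus : measurable_fun setT expRplus.
Proof.
move=> _ _ [B mB <-]; rewrite setTI setTI -comp_preimage -[X in measurable X]setTI.
exact: measurable_expR.
Qed.

HB.instance Definition _ :=
  isMeasurableFun.Build _ _ _ _ expRplus measurable_expRplus.

Definition lognormal (sigma : R) : probability (Rplus R) R :=
  distribution (normal_prob 0 sigma) expRplus.

End lognormal.

Definition atom d (T : measurableType d) (R : realType)
    (P : probability T R) (B : set T) : Prop :=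
  [/\ measurable B, (0 < P B)%E &
      forall C, measurable C -> C `<=` B -> (P C < P B)%E -> P C = 0%E].

Definition non_atomic d (T : measurableType d) (R : realType)
    (P : probability T R) : Prop := forall B, ~ atom P B.

(* Main.v *)
Require Import Defs.
From HB Require Import structures.
From mathcomp Require Import all_boot all_order all_algebra.
From mathcomp Require Import all_classical all_reals all_analysis.
From mathcomp Require Import measurable_realfun lra.

(** The completion of a metric [d] on [V_oo] is connected as soon as, for every
    cell [w], no clopen set separates the two end points of [w]: every clopen
    set then contains all of [V_oo] or none of it.

    Consider first the whole space, seen as the cell of depth 0, and call a cell
    geodesic when a shortest path from [I] to [O] visits its initial vertex, its
    middle vertex and its final vertex in this order.  If a clopen set separates
    [I] from [O], one can descend through geodesic cells which it all cuts.  The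
    initial vertices of these cells are met in order along a path of finite
    length, so they form a Cauchy sequence; if the lengths of the cells tend to
    [0], then the final vertices have the same limit, which lies on both sides
    of the cut ([cut_not_clopen]).  Hence the only obstruction is a jump: a
    nested sequence of geodesic cells whose lengths stay away from [0].  Along a
    jump the lengths converge to a positive limit, hence from some cell on they
    all are within a factor [1 + eps] of the length of that cell.

    A jump does not exist almost surely.  Write [D_e] for the distance between
    [I] and [O] in the piece [e].  Gluing puts the distance
    [min (D_e1, D_e2) + min (D_e3, D_e4)], up to a scalar, between [I] and [O].
    If a geodesic cell of depth [n + 1] inside the piece [e] carries almost the
    whole length, then (a) a geodesic cell of depth [n] carries almost the whole
    length in the piece [e], (b) the piece parallel to [e] is not shorter than
    [D_e], and (c) one of the two pieces in series with [e] is shorter than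
    [eps * D_e].  According as [D_e] is large or not, (b) or (c) says that some
    other piece, independent of the piece [e], has an atypically large or small
    length ([unbalanced_root_step]).  Therefore each level at least halves the
    probability of the event, once [eps] is small.

    This uses that a piece which is not longer than the parallel one is
    isometrically embedded, up to the scalar, in the glued space
    ([glue_dist_shortest]).  In a longer piece, and in the cells below it, the
    parallel piece creates shortcuts, but these only decrease distances, and
    the argument of the second paragraph survives a Lipschitz map.  What remains
    is that the metrics of the pieces are not functions of the glued metric; so
    it is shown that almost every [d] is, on each cell, dominated by a multiple
    of a metric from a compact set of metrics without jumps, which is a closed
    condition on [d] ([undominated_null]). *)

Set Implicit Arguments.
Unset Strict Implicit.
Unset Printing Implicit Defensive.

Import Order.TTheory GRing.Theory Num.Def Num.Theory.
Import numFieldNormedType.Exports.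

Local Open Scope classical_set_scope.
Local Open Scope ring_scope.

(** * Distances in the glued space *)

Definition partner (e : edge) : edge :=
  match e with e1 => e2 | e2 => e1 | e3 => e4 | e4 => e3 end.

Definition front (e : edge) : bool :=
  match e with e1 | e2 => true | e3 | e4 => false end.

Section gluing.
Context {R : realType} (d : edge -> vmetric R).

Lemma chain_lip (g : vertex -> R) :
  (forall e a b, g (copy e b) <= g (copy e a) + d e a b) ->
  forall x y l, chain d x y l -> g y <= g x + l.
Proof.
move=> glip x y l; elim=> [z|e a b z k _ IH]; first by rewrite addr0.
by rewrite (le_trans IH)// addrA lerD2r.
Qed.

Lemma chain_length_ge0 x y l : chain d x y l -> 0 <= l.
Proof. by elim=> // e a b z k _ k0; rewrite addr_ge0 ?vdist_ge0. Qed.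

Lemma chain_exists x y : exists l, chain d x y l.
Proof.
have [->|xy] := pselect (x = y); first by exists 0; exact: chain_nil.
apply: contrapT => nochain; have := glue_dist_gt0 d xy.
rewrite /glue_dist (_ : [set l | _] = set0) ?inf0 ?ltxx//.
by apply/seteqP; split=> // l xyl; case: nochain; exists l.
Qed.

Lemma glue_dist_copy_le e a b :
  glue_dist d (copy e a) (copy e b) <= d e a b.
Proof.
apply: ge_inf; first by exists 0 => l; exact: chain_length_ge0.
rewrite /= -[d e a b]addr0.
by apply: chain_cons; exact: chain_nil.
Qed.

(** A function that is 1-Lipschitz on each piece is 1-Lipschitz along chains; all
    lower bounds on glued distances come from such a function. *)
Lemma glue_dist_lip (g : vertex -> R) :
  (forall e a b, g (copy e b) <= g (copy e a) + d e a b) ->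
  forall x y, g y - g x <= glue_dist d x y.
Proof.
move=> glip x y; apply: lb_le_inf => [|l /= xyl]; first exact: chain_exists.
by rewrite lerBlDl; exact: chain_lip xyl.
Qed.

(** The shared vertices [I], [M], [O] are given the values which [h] takes on the
    pieces [e1] and [e3]; [glue_fun_lip] asks the other pieces to agree. *)
Definition glue_fun (h : edge -> vertex -> R) (x : vertex) : R :=
  match x with
  | vI => h e1 vI
  | vO => h e3 vO
  | vM [::] => h e1 vO
  | vM (e :: w) => h e (vM w)
  end.

Lemma glue_fun_lip (h : edge -> vertex -> R) :
  (forall e a b, h e b <= h e a + d e a b) ->
  h e1 vI = h e2 vI -> h e1 vO = h e2 vO -> h e1 vO = h e3 vI ->
  h e1 vO = h e4 vI -> h e3 vO = h e4 vO ->
  forall e f a b, h f b - h e a <= glue_dist d (copy e a) (copy f b).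
Proof.
move=> hlip h1 h2 h3 h4 h5.
have hE e a : glue_fun h (copy e a) = h e a by case: e; case: a.
move=> e f a b; rewrite -!hE; apply: glue_dist_lip => e' a' b'.
by rewrite !hE.
Qed.

(** A pair of parallel pieces meets the rest of the space in [M] only, so a
    function on the pair extends to the rest by its value at [M]. *)
Lemma side_lip e (g h : vertex -> R) :
  (forall a b, g b <= g a + d e a b) ->
  (forall a b, h b <= h a + d (partner e) a b) ->
  g vI = h vI -> g vO = h vO ->
  forall a b, g b - g a <= glue_dist d (copy e a) (copy e b).
Proof.
move=> glip hlip ghI ghO a b.
pose c := if front e then g vO else g vI.
pose k f x := match e, f with
  | e1, e1 | e2, e2 | e3, e3 | e4, e4 => g x
  | e1, e2 | e2, e1 | e3, e4 | e4, e3 => h x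
  | _, _ => c end.
have -> : g b - g a = k e b - k e a by rewrite /k; case: (e).
apply: glue_fun_lip; rewrite /k /c; case: (e) glip hlip => //= glip hlip.
all: by case=> a' b' //=; rewrite lerDl vdist_ge0.
Qed.

(** A detour through a parallel piece that is at least as long saves nothing. The
    Lipschitz function is the distance to [a], with detours in the parallel
    piece [h]; its values at [I] and [O] match because of [short]. *)
Lemma glue_dist_shortest e : d e vI vO <= d (partner e) vI vO ->
  forall a b, glue_dist d (copy e a) (copy e b) = d e a b.
Proof.
move=> short a b; apply/eqP; rewrite eq_le glue_dist_copy_le/=.
pose h z := minr (d e a vI + d (partner e) vI z) (d e a vO + d (partner e) vO z).
rewrite -[leLHS]subr0 -{1}(vdistxx (d e) a).
apply: (@side_lip e (d e a) h) => [x y|x y||]; first exact: vdist_triangle.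
- rewrite /h; have := vdist_triangle (d (partner e)) vI x y.
  have := vdist_triangle (d (partner e)) vO x y.
  by rewrite !minEle; do 2 case: ifPn; rewrite -?ltNge; lra.
- rewrite /h vdistxx addr0; apply/esym/min_idPl.
  rewrite (vdistC _ vO vI); have := vdist_triangle (d e) a vO vI.
  by rewrite (vdistC _ vO vI); lra.
- rewrite /h vdistxx addr0; apply/esym/min_idPr.
  by have := vdist_triangle (d e) a vI vO; lra.
Qed.

(** Every path from [I] to [O] through an inner vertex of the longer piece either
    runs through that piece entirely, or runs through the shorter piece and in
    addition makes a nontrivial excursion to [x]. *)
Lemma glue_dist_detour e : d (partner e) vI vO < d e vI vO ->
  forall x, x <> vI -> x <> vO ->
  d (partner e) vI vO <
  glue_dist d (copy e vI) (copy e x) + glue_dist d (copy e x) (copy e vO).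
Proof.
move=> long x xI xO; set p := partner e in long *.
pose g1 z := minr (d e vI z) (d p vI vO + d e vO z).
pose g2 z := minr (d e vO z) (d p vI vO + d e vI z).
(* [g1] and [g2] are the distances to the two ends of the pair of pieces. *)
have lip1 : g1 x - g1 vI <= glue_dist d (copy e vI) (copy e x).
  apply: (@side_lip e g1 (d p vI)) => [a b|a b||]; last 3 first.
  - exact: vdist_triangle.
  - by rewrite /g1 !vdistxx; apply/min_idPl; rewrite addr_ge0 ?vdist_ge0.
  - by rewrite /g1 !vdistxx addr0; apply/min_idPr/ltW.
  rewrite /g1; have := vdist_triangle (d e) vI a b.
  have := vdist_triangle (d e) vO a b.
  by rewrite !minEle; do 2 case: ifPn; rewrite -?ltNge; lra.
have lip2 : g2 x - g2 vO <= glue_dist d (copy e x) (copy e vO).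
  rewrite glue_distC.
  apply: (@side_lip e g2 (d p vO)) => [a b|a b||]; last 3 first.
  - exact: vdist_triangle.
  - rewrite /g2 !vdistxx addr0 (vdistC _ vO vI) (vdistC _ vO vI).
    exact/min_idPr/ltW.
  - by rewrite /g2 !vdistxx; apply/min_idPl; rewrite addr_ge0 ?vdist_ge0.
  rewrite /g2; have := vdist_triangle (d e) vI a b.
  have := vdist_triangle (d e) vO a b.
  by rewrite !minEle; do 2 case: ifPn; rewrite -?ltNge; lra.
have g1I : g1 vI = 0.
  by rewrite /g1 !vdistxx; apply/min_idPl; rewrite addr_ge0 ?vdist_ge0.
have g2O : g2 vO = 0.
  by rewrite /g2 !vdistxx; apply/min_idPl; rewrite addr_ge0 ?vdist_ge0.
apply: (lt_le_trans _ (lerD lip1 lip2)); rewrite g1I g2O !subr0 /g1 /g2.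
have := vdist_triangle (d e) vI x vO; rewrite (vdistC _ x vO).
have := vdist_ge0 (d p) vI vO.
have : 0 < d e vI x by apply: vdist_gt0 => /esym.
have : 0 < d e vO x by apply: vdist_gt0 => /esym.
by rewrite !minEle; do 2 case: ifPn; rewrite -?ltNge; lra.
Qed.

(** [M] is a cut vertex.  The Lipschitz function is the distance to [copy e a] in
    front of [M], continued behind [M] as if every path had to visit [M]. *)
Lemma glue_dist_cut e f a b : front e -> ~~ front f ->
  glue_dist d (copy e a) (copy f b) =
  glue_dist d (copy e a) (vM [::]) + glue_dist d (vM [::]) (copy f b).
Proof.
move=> fe nf; apply/eqP; rewrite eq_le glue_dist_triangle/=.
set x := copy e a; set M := vM [::].
pose h e' z := if front e' then glue_dist d x (copy e' z)
  else glue_dist d x M + glue_dist d M (copy e' z).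
have -> : glue_dist d x M + glue_dist d M (copy f b) = h f b - h e a.
  by rewrite /h fe (negbTE nf) glue_distxx subr0.
apply: glue_fun_lip; rewrite /h //= ?glue_distxx ?addr0// => e' a' b'.
have le := glue_dist_copy_le e' a' b'.
case: ifP => _; rewrite -?addrA ?lerD2l.
  by rewrite (le_trans (glue_dist_triangle _ _ (copy e' a') _))// lerD2l.
by rewrite (le_trans (glue_dist_triangle _ _ (copy e' a') _))// lerD2l.
Qed.

End gluing.

(** * Geodesic cells *)

Section cells.
Context {R : realType}.
Implicit Types (d : vmetric R) (w : seq edge).

Definition cell_length d w : R := d (ends w).1 (ends w).2.

(** The middle vertex [vM w] is part of the condition: two parallel cells have the
    same end points, and only their inner vertices tell which one a shortest
    path uses. *)
Definition geodesic d w : Prop :=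
  d vI (ends w).1 + d (ends w).1 (vM w) + d (vM w) (ends w).2 + d (ends w).2 vO
    <= d vI vO.

Lemma geodesic_length_le d w : geodesic d w -> cell_length d w <= d vI vO.
Proof.
rewrite /geodesic /cell_length; have := vdist_triangle d (ends w).1 (vM w) (ends w).2.
have := vdist_ge0 d vI (ends w).1; have := vdist_ge0 d (ends w).2 vO; lra.
Qed.

Lemma geodesic_mid d w : geodesic d w ->
  d (ends w).1 (vM w) + d (vM w) (ends w).2 <= cell_length d w.
Proof.
rewrite /geodesic /cell_length; have := vdist_triangle d vI (ends w).1 vO.
have := vdist_triangle d (ends w).1 (ends w).2 vO; lra.
Qed.

Definition shortest (d : edge -> vmetric R) e : Prop :=
  d e vI vO <= d (partner e) vI vO.

Lemma shortest_exists (d : edge -> vmetric R) (b : bool) :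
  exists2 f, front f = b & shortest d f.
Proof.
rewrite /shortest; case: b.
  by case: (leP (d e1 vI vO) (d e2 vI vO)) => [?|/ltW ?]; [exists e1|exists e2].
by case: (leP (d e3 vI vO) (d e4 vI vO)) => [?|/ltW ?]; [exists e3|exists e4].
Qed.

End cells.

Section glued_cells.
Context {R : realType} (d : edge -> vmetric R) (lam xi : Rplus R).
Local Notation D := (glue_vmetric d lam xi).
Local Notation k := (rval lam * rval xi).

Let k_gt0 : 0 < k. Proof. by rewrite mulr_gt0 ?rval_gt0. Qed.

Lemma glue_vmetric_copy_le e a b : D (copy e a) (copy e b) <= k * d e a b.
Proof. by rewrite ler_pM2l// glue_dist_copy_le. Qed.

Lemma glue_length e f : shortest d e -> shortest d f -> front f = ~~ front e ->
  D vI vO = k * (d e vI vO + d f vI vO).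
Proof.
wlog fe : e f / front e => [H se sf fef|se sf].
  case: (boolP (front e)) => fe; first exact: H.
  by rewrite addrC; apply: H; rewrite ?fef ?negbK.
rewrite fe /= => nf; congr (_ * _).
have := glue_dist_cut d vI vO fe (negbT nf).
rewrite -(glue_dist_shortest se) -(glue_dist_shortest sf).
by case: (e) (f) fe nf => -[].
Qed.

Lemma cell_length_glue e w : shortest d e ->
  cell_length D (e :: w) = k * cell_length (d e) w.
Proof. by move=> se; congr (_ * _); exact: glue_dist_shortest. Qed.

(** By the cut vertex [M], the part of the path outside the pair of pieces that
    contains [e] contributes the same length to both sides. *)
Lemma geodesic_glue_local e w : geodesic D (e :: w) <->
  glue_dist d (copy e vI) (copy e (ends w).1) +
  glue_dist d (copy e (ends w).1) (copy e (vM w)) +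
  glue_dist d (copy e (vM w)) (copy e (ends w).2) +
  glue_dist d (copy e (ends w).2) (copy e vO)
    <= glue_dist d (copy e vI) (copy e vO).
Proof.
rewrite /geodesic /= -!mulrDr ler_pM2l// -[vM (e :: w)]/(copy e (vM w)).
have cutIO : glue_dist d vI vO =
    glue_dist d vI (vM [::]) + glue_dist d (vM [::]) vO.
  exact: (@glue_dist_cut _ d e1 e3 vI vO).
case: (boolP (front e)) => fe.
  have -> : glue_dist d (copy e (ends w).2) vO =
      glue_dist d (copy e (ends w).2) (vM [::]) + glue_dist d (vM [::]) vO.
    exact: (@glue_dist_cut _ d e e3 _ vO).
  by rewrite cutIO addrA lerD2r; case: (e) fe.
have -> : glue_dist d vI (copy e (ends w).1) =
    glue_dist d vI (vM [::]) + glue_dist d (vM [::]) (copy e (ends w).1).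
  exact: (@glue_dist_cut _ d e1 e vI).
by rewrite cutIO -!addrA lerD2l !addrA; case: (e) fe.
Qed.

(** Shortest paths enter a piece only if it is at most as long as the parallel one,
    and there the glued metric is the metric of the piece. *)
Lemma geodesic_glue e w :
  geodesic D (e :: w) <-> shortest d e /\ geodesic (d e) w.
Proof.
rewrite geodesic_glue_local; have [se|] := leP (d e vI vO) (d (partner e) vI vO).
  by rewrite !(glue_dist_shortest se); split=> [|[]].
move=> long; split=> [|[]]; last by rewrite /shortest leNgt long.
have : d (partner e) vI vO < glue_dist d (copy e vI) (copy e (vM w)) +
    glue_dist d (copy e (vM w)) (copy e vO) by exact: glue_dist_detour.
have := glue_dist_triangle d (copy e vI) (copy e (ends w).1) (copy e (vM w)).
have := glue_dist_triangle d (copy e (vM w)) (copy e (ends w).2) (copy e vO).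
suff : glue_dist d (copy e vI) (copy e vO) <= d (partner e) vI vO by lra.
have -> : glue_dist d (copy e vI) (copy e vO) =
    glue_dist d (copy (partner e) vI) (copy (partner e) vO) by case: (e).
exact: glue_dist_copy_le.
Qed.

Lemma geodesic_glue_root : geodesic D [::].
Proof.
rewrite /geodesic /= -!mulrDr ler_pM2l// !glue_distxx add0r addr0.
by rewrite -(@glue_dist_cut _ d e1 e3 vI vO).
Qed.

(** If a cell inside the piece [e] carries almost the whole distance from [I] to
    [O], then little is left for the two pieces in series with [e]. *)
Lemma dominant_cell_glue eps e w :
  geodesic D (e :: w) -> D vI vO < (1 + eps) * cell_length D (e :: w) ->
  d e vI vO < (1 + eps) * cell_length (d e) w /\
  exists2 f, front f = ~~ front e & d f vI vO < eps * d e vI vO.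
Proof.
move=> /geodesic_glue[se gw].
have [f fe sf] := shortest_exists d (~~ front e).
rewrite (glue_length se sf fe) cell_length_glue// mulrCA ltr_pM2l// => lt.
have le := geodesic_length_le gw; have := vdist_ge0 (d f) vI vO => f0.
have eps0 : 0 <= 1 + eps.
  rewrite leNgt; apply/negP => eps0.
  have := vdist_ge0 (d e) (ends w).1 (ends w).2; rewrite -/(cell_length (d e) w).
  have := vdist_ge0 (d e) vI vO; nra.
split; first by lra.
by exists f => //; nra.
Qed.

End glued_cells.

(** * Clopen sets and geodesic cells *)

(** The infimum [l] of the sequence satisfies [(1 + eps) * l <= l]. *)
Lemma nonincreasing_cvg0 (R : realType) (a : nat -> R) (eps : R) : 0 < eps ->
  (forall n, 0 <= a n) -> (forall n, a n.+1 <= a n) ->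
  (forall m, exists n, (1 + eps) * a (m + n)%N <= a m) ->
  a n @[n --> \oo] --> 0.
Proof.
move=> eps0 a0 adec aratio.
have lb : has_lbound (range a) by exists 0 => _ [n _ <-].
have acvg := nonincreasing_cvgn (iffLR (nonincreasing_seqP a) adec) lb.
suff <- : inf (range a) = 0 by [].
have ne : range a !=set0 by exists (a 0%N), 0%N.
have i0 : 0 <= inf (range a) by apply: lb_le_inf => // _ [n _ <-].
suff : (1 + eps) * inf (range a) <= inf (range a) by nra.
apply: lb_le_inf => // _ [m _ <-]; have [n] := aratio m.
by apply: le_trans; rewrite ler_pM2l ?addr_gt0//; apply: ge_inf => //; exists (m + n)%N.
Qed.

(** The deterministic properties of almost every metric that keep [I] and [O]
    together.  The last one excludes jumps: below any depth [m] there is a depth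
    at which all geodesic cells have become shorter by the factor [1 + eps]. *)
Record tame (R : realType) (eps : R) (d : vmetric R) : Prop := Tame {
  tame_root : geodesic d [::] ;
  tame_child : forall w (b : bool), geodesic d w ->
    exists2 e, front e = b & geodesic d (rcons w e) ;
  tame_shrink : forall m, exists n, forall u v, size u = m -> size v = n ->
    geodesic d (u ++ v) -> (1 + eps) * cell_length d (u ++ v) <= cell_length d u }.

Section not_separated.
Context {R : realType}.

(** Summed along a nested sequence of geodesic cells, this bounds the distance
    between the initial vertices of two of them by the length of the larger. *)
Lemma geodesic_child_src (d : vmetric R) w e : geodesic d w ->
  d (ends w).1 (ends (rcons w e)).1 + cell_length d (rcons w e) <= cell_length d w.
Proof.
move=> /geodesic_mid; rewrite /cell_length ends_rcons.
have := vdist_ge0 d (ends w).1 (vM w); have := vdist_ge0 d (vM w) (ends w).2.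
by case: e => /=; rewrite ?vdistxx; lra.
Qed.

Variables (eps : R) (d : vmetric R) (X : metricType R) (j : vertex -> X) (C : R).
Hypothesis eps_gt0 : 0 < eps.
Hypothesis d_tame : tame eps d.
Hypothesis X_complete :
  forall F : set_system X, ProperFilter F -> cauchy F -> exists p : X, F --> p.
Hypothesis C_ge0 : 0 <= C.
Hypothesis j_lip : forall x y, mdist (j x) (j y) <= C * d x y.

Section cut.
Variable U : set X.
Hypothesis UI : U (j vI).
Hypothesis UO : ~ U (j vO).

Let crossing w := [/\ geodesic d w, U (j (ends w).1) & ~ U (j (ends w).2)].

(* If [M] is in [U] the cut is between [M] and [O], otherwise between [I] and [M]. *)
Let crossing_ray : exists2 ray : nat -> seq edge, forall n, crossing (ray n) &
  forall n, exists e, ray n.+1 = rcons (ray n) e.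
Proof.
have step w : exists e, crossing w -> crossing (rcons w e).
  have [[gw Uw1 Uw2]|] := pselect (crossing w); last by exists e1.
  have [b be] : exists b : bool, forall e, front e = b ->
      U (j (ends (rcons w e)).1) /\ ~ U (j (ends (rcons w e)).2).
    have [UM|UM] := pselect (U (j (vM w))); [exists false|exists true];
      by case=> //= _; rewrite ends_rcons.
  have [e eb ge] := tame_child d_tame b gw.
  by exists e => _; have [] := be _ eb.
have [next nextP] := choice step.
exists (fun n => iter n (fun w => rcons w (next w)) [::]) => [|n]; last first.
  by exists (next (iter n (fun w => rcons w (next w)) [::])).
by elim=> [|n /nextP//]; split=> //; exact: tame_root d_tame.
Qed.

(** The end points of nested geodesic cells which are all cut by [U] converge to a
    common limit.  The map [j] need not be isometric, so that this also applies
    to cells in which distances have been decreased by shortcuts. *)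
Lemma cut_not_clopen : open U -> closed U -> False.
Proof.
move=> oU cU; have [ray rayP rayS] := crossing_ray.
pose a n := cell_length d (ray n).
have a_ge0 n : 0 <= a n by exact: vdist_ge0.
have child n : d (ends (ray n)).1 (ends (ray n.+1)).1 + a n.+1 <= a n.
  by have [e re] := rayS n; rewrite /a re; apply: geodesic_child_src; have [] := rayP n.
have adec n : a n.+1 <= a n.
  by apply: le_trans (child n); rewrite lerDr vdist_ge0.
have ray_cat m n : exists2 v, ray (m + n)%N = ray m ++ v & size v = n.
  elim: n => [|n [v rv sv]]; first by exists [::]; rewrite ?addn0 ?cats0.
  have [e re] := rayS (m + n)%N; exists (rcons v e); last by rewrite size_rcons sv.
  by rewrite addnS re rv rcons_cat.
have acvg : C * a n @[n --> \oo] --> 0.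
  rewrite -(mulr0 C); apply: cvgMr; apply: (nonincreasing_cvg0 eps_gt0) => // m.
  have [n nP] := tame_shrink d_tame (size (ray m)); exists n.
  have [v rv sv] := ray_cat m n; rewrite /a rv; apply: nP => //.
  by rewrite -rv; have [] := rayP (m + n)%N.
pose x n := j (ends (ray n)).1; pose y n := j (ends (ray n)).2.
have xclose m n : mdist (x m) (x (m + n)%N) <= C * a m.
  apply: le_trans (j_lip _ _) _; apply: ler_wpM2l => //.
  suff : d (ends (ray m)).1 (ends (ray (m + n)%N)).1 + a (m + n)%N <= a m.
    by have := a_ge0 (m + n)%N; lra.
  elim: n => [|n IH]; first by rewrite addn0 vdistxx add0r.
  rewrite addnS; have := child (m + n)%N.
  have := vdist_triangle d (ends (ray m)).1 (ends (ray (m + n)%N)).1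
    (ends (ray (m + n).+1)).1.
  lra.
have [p xp] : exists p : X, x n @[n --> \oo] --> p.
  apply: X_complete; apply/cauchyP => e e0.
  have [N _ NP] : \forall n \near \oo, C * a n < e by exact: cvgr_lt acvg _ e0.
  exists (x N); exists N => // n /= Nn.
  rewrite ballEmdist /= -(subnKC Nn); apply: le_lt_trans (xclose _ _) _.
  exact: (NP N (leqnn N)).
have Up : U p.
  by apply: (closed_cvg U cU _ _ xp); apply: nearW => n; have [] := rayP n.
have [e /= e0 eU] : nbhs_ball p U.
  by rewrite nbhs_ballE; exact: open_nbhs_nbhs.
have e20 : 0 < e / 2 by rewrite divr_gt0.
have [N _ NP] : \forall n \near \oo, C * a n < e / 2.
  exact: cvgr_lt acvg _ e20.
have [M _ MP] : \forall n \near \oo, ball p (e / 2) (x n).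
  exact: (cvg_ball xp).
pose n := maxn N M; have [_ _] := rayP n; apply; apply: eU.
have := MP n (leq_maxr _ _); have := NP n (leq_maxl _ _).
rewrite /= !ballEmdist/= => ha hx.
apply: le_lt_trans (metric_triangle _ (x n) _) _.
have := j_lip (ends (ray n)).1 (ends (ray n)).2.
rewrite -/(x n) -/(y n) -/(cell_length d (ray n)) -/(a n).
lra.
Qed.

End cut.

Lemma tame_not_separated (U : set X) : open U -> closed U ->
  U (j vI) -> U (j vO).
Proof. by move=> oU cU UI; apply: contrapT => UO; exact: (cut_not_clopen UI UO). Qed.

End not_separated.

(** * Measurability *)

Definition nat_of_edge (e : edge) : nat :=
  match e with e1 => 0 | e2 => 1 | e3 => 2 | e4 => 3 end.

Definition edge_of_nat (n : nat) : edge :=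
  match n with 0 => e1 | 1 => e2 | 2 => e3 | _ => e4 end.

Lemma nat_of_edgeK : cancel nat_of_edge edge_of_nat. Proof. by case. Qed.

HB.instance Definition _ := Countable.copy edge (can_type nat_of_edgeK).

Definition code_vertex (x : vertex) : option (option (seq edge)) :=
  match x with vI => None | vO => Some None | vM w => Some (Some w) end.

Definition decode_vertex (c : option (option (seq edge))) : vertex :=
  match c with None => vI | Some None => vO | Some (Some w) => vM w end.

Lemma code_vertexK : cancel code_vertex decode_vertex. Proof. by case. Qed.

HB.instance Definition _ := CanIsCountable code_vertexK.

Section evaluation.
Context {R : realType}.

Lemma continuous_eval (x y : vertex) : continuous (fun d : vmetric R => d x y).
Proof.
move=> d; pose g (d : vmetric R) : {ptws (vertex * vertex) -> R} :=
  fun p => d p.1 p.2.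
apply: (@continuous_comp _ _ _ g (fun f => f (x, y))).
  exact: (@initial_continuous _ _ g).
exact: (@proj_continuous _ (fun _ => R) (x, y)).
Qed.

Lemma vmetric_open_measurable (U : set (vmetric R)) : open U -> measurable U.
Proof. exact: sub_sigma_algebra. Qed.

Lemma measurable_eval (x y : vertex) :
  measurable_fun [set: vmetric R] (fun d : vmetric R => d x y).
Proof.
apply: (measurability _ (RGenInftyO.measurableE R)) => _ [_ [r ->] <-].
rewrite setTI; apply: vmetric_open_measurable.
by apply: open_comp; [move=> ? _; exact: continuous_eval|exact: interval_open].
Qed.

Lemma vmetric_ext (d d' : vmetric R) : (forall x y, d x y = d' x y) -> d = d'.
Proof.
move=> dd'; have : vdist d = vdist d' by apply/funext => x; apply/funext => y.
case: d d' {dd'} => [f a b c t] [f' a' b' c' t'] /= ff'; subst f'.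
by congr MkVMetric; exact: Prop_irrelevance.
Qed.

Lemma vmetric_hausdorff : hausdorff_space (vmetric R).
Proof.
move=> d d' dd'; apply: vmetric_ext => x y.
apply: (@Rhausdorff R) => A B /= nA nB.
have [] := dd' ((fun d : vmetric R => d x y) @^-1` A)
  ((fun d : vmetric R => d x y) @^-1` B).
- exact: continuous_eval.
- exact: continuous_eval.
- by move=> c [? ?]; exists (c x y).
Qed.

End evaluation.

Section cylindrical.
Context {R : realType}.

(** Measurable functions of the distances [d x y].  The definition through all
    [f] gives measurability both on the space of metrics and on its preimage
    under the gluing map, the coordinates of which are infima of countably many
    functions. *)
Definition cylindrical_fun (F : vmetric R -> R) : Prop :=
  forall dT (T : measurableType dT) (f : T -> vmetric R),
    (forall x y, measurable_fun setT (fun t => f t x y)) ->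
    measurable_fun setT (F \o f).

Definition cylindrical (A : set (vmetric R)) : Prop :=
  forall dT (T : measurableType dT) (f : T -> vmetric R),
    (forall x y, measurable_fun setT (fun t => f t x y)) -> measurable (f @^-1` A).

Lemma cylindrical_measurable A : cylindrical A -> measurable A.
Proof. by move=> /(_ _ _ id); apply; exact: measurable_eval. Qed.

Lemma cylindrical_eval x y : cylindrical_fun (fun d => d x y).
Proof. by move=> dT T f; exact. Qed.

Lemma cylindrical_cst (r : R) : cylindrical_fun (fun=> r).
Proof. by move=> dT T f _; exact: measurable_cst. Qed.

Lemma cylindricalD F G : cylindrical_fun F -> cylindrical_fun G ->
  cylindrical_fun (fun d => F d + G d).
Proof.
by move=> cF cG dT T f mf; apply: measurable_funD; [exact: cF|exact: cG].
Qed.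

Lemma cylindricalM F G : cylindrical_fun F -> cylindrical_fun G ->
  cylindrical_fun (fun d => F d * G d).
Proof.
by move=> cF cG dT T f mf; apply: measurable_funM; [exact: cF|exact: cG].
Qed.

Lemma cylindrical_le F G : cylindrical_fun F -> cylindrical_fun G ->
  cylindrical [set d | F d <= G d].
Proof.
move=> cF cG dT T f mf.
have mb := measurable_fun_ler (cF _ _ _ mf) (cG _ _ _ mf).
have := mb measurableT [set true] I; by rewrite setTI.
Qed.

Lemma cylindricalC A : cylindrical A -> cylindrical (~` A).
Proof. by move=> cA dT T f mf; apply: measurableC; exact: cA. Qed.

Lemma cylindrical_lt F G : cylindrical_fun F -> cylindrical_fun G ->
  cylindrical [set d | F d < G d].
Proof.
move=> cF cG; have := cylindricalC (cylindrical_le cG cF).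
by congr cylindrical; apply/seteqP; split=> d /=; rewrite ltNge => /negP.
Qed.

Lemma cylindrical_and A B : cylindrical A -> cylindrical B ->
  cylindrical [set d | A d /\ B d].
Proof.
by move=> cA cB dT T f mf; apply: measurableI; [exact: cA|exact: cB].
Qed.

Lemma cylindrical_or A B : cylindrical A -> cylindrical B ->
  cylindrical [set d | A d \/ B d].
Proof.
by move=> cA cB dT T f mf; apply: measurableU; [exact: cA|exact: cB].
Qed.

Lemma cylindrical_prop (P : Prop) : cylindrical [set d | P].
Proof.
move=> dT T f _; have [p|p] := pselect P.
  by rewrite (_ : _ @^-1` _ = setT)//; apply/seteqP; split.
by rewrite (_ : _ @^-1` _ = set0)//; apply/seteqP; split.
Qed.

Lemma cylindrical_exists (I : countType) (A : I -> set (vmetric R)) :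
  (forall i, cylindrical (A i)) -> cylindrical [set d | exists i, A i d].
Proof.
move=> cA dT T f mf; rewrite (_ : _ @^-1` _ = \bigcup_i (f @^-1` A i)).
  by apply: countable_bigcupT_measurable => // i; exact: cA.
by apply/seteqP; split=> t /= [i]; exists i.
Qed.

Lemma cylindrical_forall (I : countType) (A : I -> set (vmetric R)) :
  (forall i, cylindrical (A i)) -> cylindrical [set d | forall i, A i d].
Proof.
move=> cA; have := cylindricalC (cylindrical_exists (fun i => cylindricalC (cA i))).
congr cylindrical; apply/seteqP; split=> d /=; first by move/forallNP => + i; move=> /(_ i)/contrapT.
by move=> Ad [i]; apply.
Qed.

Lemma cylindrical_imply A B : cylindrical A -> cylindrical B ->
  cylindrical [set d | A d -> B d].
Proof.
move=> cA cB; have := cylindrical_or (cylindricalC cA) cB.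
congr cylindrical; apply/seteqP; split=> d /=; first by move=> [|].
by move=> AB; have [/AB|] := pselect (A d); [right|left].
Qed.

End cylindrical.

Section measurable_gluing.
Context {R : realType}.

(** Chains are coded by lists because there are countably many of these. *)
Fixpoint is_chain (x : vertex) (s : seq (edge * vertex * vertex)) (y : vertex) : Prop :=
  if s is (e, a, b) :: s' then x = copy e a /\ is_chain (copy e b) s' y else x = y.

Fixpoint chain_length (d : edge -> vmetric R) (s : seq (edge * vertex * vertex)) : R :=
  if s is (e, a, b) :: s' then d e a b + chain_length d s' else 0.

Lemma chainP (d : edge -> vmetric R) x y l : chain d x y l <->
  exists2 s, is_chain x s y & l = chain_length d s.
Proof.
split; first by elim=> [z|e a b z k _ [s sc ->]];
  [exists [::]|exists ((e, a, b) :: s)].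
move=> [s + ->]; elim: s x => [x ->|[[e a] b] s IH x /= [-> /IH]]; first exact: chain_nil.
exact: chain_cons.
Qed.

Lemma measurable_glue_dist dT (T : measurableType dT)
    (d : T -> edge -> vmetric R) (x y : vertex) :
  (forall e a b, measurable_fun setT (fun t => d t e a b)) ->
  measurable_fun setT (fun t => glue_dist (d t) x y).
Proof.
move=> md; apply: (measurability _ (RGenInftyO.measurableE R)) => _ [_ [r ->] <-].
rewrite setTI.
rewrite (_ : _ @^-1` _ = \bigcup_s [set t | is_chain x s y /\ chain_length (d t) s < r]).
  apply: countable_bigcupT_measurable => // s.
  have [c|c] := pselect (is_chain x s y); last first.
    by rewrite (_ : [set t | _] = set0)//; apply/seteqP; split=> // t [].
  have ml : measurable_fun setT (fun t => chain_length (d t) s).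
    elim: s {c} => [|[[e a] b] s IH] /=; first exact: measurable_cst.
    by apply: measurable_funD.
  have := ml measurableT [set` `]-oo, r[] (measurable_itv _); rewrite setTI.
  congr measurable; apply/seteqP; split=> t /=; rewrite in_itv/=; first by split.
  by case.
apply/seteqP; split=> t /=; rewrite in_itv/=.
  move=> /(inf_lt (chain_exists (d t) x y))[l /chainP[s sc ->] lr].
  by exists s.
move=> [s _ [sc]]; apply: le_lt_trans; apply: ge_inf.
  by exists 0 => l; exact: chain_length_ge0.
by apply/chainP; exists s.
Qed.

Definition pieces (x : ((vmetric R * vmetric R) * (vmetric R * vmetric R)) * Rplus R)
    (e : edge) : vmetric R :=
  match e with e1 => x.1.1.1 | e2 => x.1.1.2 | e3 => x.1.2.1 | e4 => x.1.2.2 end.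

Lemma glue_mapE (lam : Rplus R) x : glue_map lam x = glue_vmetric (pieces x) lam x.2.
Proof. by case: x => [[[d1 d2] [d3 d4]] xi]. Qed.

Lemma measurable_pieces e : measurable_fun setT (pieces^~ e).
Proof.
by case: e; repeat (apply: measurableT_comp => //).
Qed.

Lemma cylindrical_glue (lam : Rplus R) (A : set (vmetric R)) : cylindrical A -> measurable (glue_map lam @^-1` A).
Proof.
apply=> x y; rewrite (_ : (fun t => _) =
    fun t => rval lam * rval t.2 * glue_dist (pieces t) x y); last first.
  by apply/funext => t; rewrite glue_mapE.
apply: measurable_funM.
  apply: measurable_funM => //.
  by apply: measurableT_comp => //; exact: measurable_rval.
apply: measurable_glue_dist => e a b.
apply: (@measurableT_comp _ _ _ _ _ _ (fun d : vmetric R => d a b)).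
  exact: measurable_eval.
exact: measurable_pieces.
Qed.

End measurable_gluing.

(** * Probability of events on one or two pieces *)

Section measure_lemmas.
Local Open Scope ereal_scope.
Context dT (T : measurableType dT) (R : realType) (mu : probability T R).

Lemma measure_seq_le (I : eqType) (s : seq I) (F : I -> set T) (A : set T) (c : \bar R) :
  measurable A -> (forall i, measurable (F i)) -> (forall i, mu (F i) <= c) ->
  (forall x, A x -> exists2 i, i \in s & F i x) -> mu A <= (size s)%:R%:E * c.
Proof.
move=> mA mF Fc; elim: s A mA => [|i s IH] A mA AF.
  rewrite mul0e (_ : A = set0) ?measure0//.
  by apply/seteqP; split=> // x /AF[].
rewrite (measureDI mu mA (mF i)) /= -natr1 EFinD ge0_muleDl ?lee_fin//.
apply: leeD; last first.
  rewrite mul1e; apply: le_trans (Fc i).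
  by apply: le_measure; rewrite ?inE//; exact: measurableI.
apply: IH => [|x [/AF[k]]]; first exact: measurableD.
by rewrite inE => /orP[/eqP->//|ks Fk _]; exists k.
Qed.

Lemma measure_vanishes (A : set T) : (forall n, mu A <= (n.+1%:R^-1)%:E) -> mu A = 0.
Proof.
move=> An; apply/eqP; rewrite eq_le measure_ge0 andbT.
apply/lee_addgt0Pr => e e0; rewrite add0e.
have [n ne] : exists n, (n.+1%:R^-1 < e)%R.
  exists (truncn e^-1); rewrite invf_plt ?posrE ?ltr0n//; exact: truncnS_gt.
by apply: le_trans (An n) _; rewrite lee_fin ltW.
Qed.

Lemma measure_small (F : nat -> set T) (c : R) : (0 < c)%R ->
  (forall n, measurable (F n)) -> (forall n, F n.+1 `<=` F n) ->
  (forall x, exists n, ~ F n x) -> exists n, mu (F n) <= c%:E.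
Proof.
move=> c0 mF dF eF.
have F0 : \bigcap_n F n = set0.
  by apply/seteqP; split=> // x Fx; have [n] := eF x; apply; exact: Fx.
have : mu \o F @ \oo --> mu (\bigcap_n F n).
  apply: nonincreasing_cvg_mu => //.
  - by apply: le_lt_trans (probability_le1 _ _) _; rewrite ?ltry.
  - by rewrite F0; exact: measurable0.
  - by apply/nonincreasing_seqP => n; apply/subsetPset.
rewrite F0 measure0 => /fine_cvgP[finF cF].
have [N _ NP] : \forall n \near \oo, (fine (mu (F n)) < c)%R.
  exact: cvgr_lt cF _ c0.
exists N; rewrite -[leLHS]fineK ?fin_num_measure//.
by rewrite lee_fin ltW//; exact: (NP N (leqnn N)).
Qed.

Lemma negligible_exists (I : countType) (A : I -> set T) :
  (forall i, measurable (A i)) -> (forall i, mu (A i) = 0) ->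
  mu.-negligible [set x | exists i, A i x].
Proof.
move=> mA A0.
pose F k := if unpickle k is Some i then A i else set0.
rewrite (_ : [set x | _] = \bigcup_k F k).
  apply: negligible_bigcup => k; rewrite /F; case: unpickle => [i|].
    exact: (negligibleP mu (mA i)).2 (A0 i).
  exact: negligible_set0.
apply/seteqP; split=> x /= [i].
  by move=> Aix; exists (pickle i) => //; rewrite /F pickleK.
by move=> _; rewrite /F; case: unpickle => // k; exists k.
Qed.

End measure_lemmas.

Lemma law5_setX dT (T : measurableType dT) (R : realType)
    (P : probability T R) (m : probability (Rplus R) R) (A1 A2 A3 A4 : set T) :
  measurable A1 -> measurable A2 -> measurable A3 -> measurable A4 ->
  (law5 P m (((A1 `*` A2) `*` (A3 `*` A4)) `*` setT) =
  P A1 * P A2 * (P A3 * P A4))%E.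
Proof.
move=> mA1 mA2 mA3 mA4.
have m12 : measurable (A1 `*` A2) by exact: measurableX.
have m34 : measurable (A3 `*` A4) by exact: measurableX.
have m14 : measurable ((A1 `*` A2) `*` (A3 `*` A4)) by exact: measurableX.
rewrite -[RHS]mule1 -(@probability_setT _ _ _ m).
etransitivity; first exact: (product_measure1E _ _ m14 measurableT).
congr (_ * _)%E.
etransitivity; first exact: (product_measure1E _ _ m12 m34).
congr (_ * _)%E; exact: product_measure1E.
Qed.

Section independence.
Local Open Scope ereal_scope.
Context {R : realType} (P : probability (vmetric R) R) (m : probability (Rplus R) R).

Lemma law5_pieces (A : edge -> set (vmetric R)) : (forall e, measurable (A e)) ->
  law5 P m [set x | forall e, A e (pieces x e)] =
  P (A e1) * P (A e2) * (P (A e3) * P (A e4)).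
Proof.
move=> mA.
rewrite (_ : [set x | _] = ((A e1 `*` A e2) `*` (A e3 `*` A e4)) `*` setT); last first.
  apply/seteqP; split=> [x Ax|x [[[? ?] [? ?]] _]] /=; last by case.
  by split.
exact: law5_setX.
Qed.

Lemma law5_piece2 e f (B C : set (vmetric R)) : measurable B -> measurable C ->
  law5 P m [set x | e <> f /\ B (pieces x e) /\ C (pieces x f)] <= P B * P C.
Proof.
move=> mB mC; have [->|ef] := pselect (e = f).
  rewrite (_ : [set x | _] = set0) ?measure0 ?mule_ge0//.
  by apply/seteqP; split=> // x [].
pose A g := if g == e then B else if g == f then C else setT.
have mA g : measurable (A g) by rewrite /A; case: ifP => // _; case: ifP.
rewrite (_ : [set x | _] = [set x | forall e, A e (pieces x e)]).
  rewrite law5_pieces// /A.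
  by case: (e) (f) ef => -[] //= _; rewrite ?probability_setT ?mule1 ?mul1e// muleC.
apply/seteqP; split=> x /=.
  move=> [_ [Bx Cx]] g; rewrite /A; case: eqP => [->//|_].
  by case: eqP => [->|].
move=> Ax; split=> //; split; first by have := Ax e; rewrite /A eqxx.
by have := Ax f; rewrite /A eqxx; case: eqP => [fe|//]; case: ef.
Qed.

Lemma law5_piece e (B : set (vmetric R)) : measurable B ->
  law5 P m [set x | B (pieces x e)] <= P B.
Proof.
move=> mB; rewrite -[leRHS]mule1 -(@probability_setT _ _ _ P).
apply: le_trans (@law5_piece2 e (partner e) B setT mB measurableT).
rewrite (_ : [set x | _] = [set x | e <> partner e /\ B (pieces x e) /\ setT (pieces x (partner e))])//.
by apply/seteqP; split=> x /= => [Bx|[_ []//]]; split=> //; case: (e).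
Qed.

End independence.

(** * Consequences of stationarity *)

Section stationary_bounds.
Local Open Scope ereal_scope.
Context {R : realType} (lam : Rplus R) (m : probability (Rplus R) R).
Variable P : probability (vmetric R) R.
Hypothesis P_stationary : stationary lam m P.

Lemma stationary_le1 (A B : set (vmetric R)) : cylindrical A -> cylindrical B ->
  (forall d xi, A (glue_vmetric d lam xi) -> exists e, B (d e)) ->
  P A <= 4%:R%:E * P B.
Proof.
move=> cA cB AB; have mB := cylindrical_measurable cB.
rewrite -(P_stationary (cylindrical_measurable cA)) /PhiM /pushforward.
apply: (@measure_seq_le _ _ _ (law5 P m) _ [:: e1; e2; e3; e4]
  (fun e => [set x | B (pieces x e)])).
- exact: cylindrical_glue.
- move=> e; rewrite -[X in measurable X]setTI; exact: measurable_pieces.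
- by move=> e; exact: law5_piece.
- move=> x /=; rewrite glue_mapE => /AB[e Be]; exists e => //.
  by case: (e).
Qed.

Lemma stationary_null (A B : set (vmetric R)) : cylindrical A -> cylindrical B ->
  (forall d xi, A (glue_vmetric d lam xi) -> exists e, B (d e)) ->
  P B = 0 -> P A = 0.
Proof.
move=> cA cB AB B0; apply/eqP; rewrite eq_le measure_ge0 andbT.
by rewrite (le_trans (stationary_le1 cA cB AB))// B0 mule0.
Qed.

(** The two pieces are distinct, hence independent; [16] bounds the number of pairs
    of pieces. *)
Lemma stationary_le2 (A B C : set (vmetric R)) :
  cylindrical A -> cylindrical B -> cylindrical C ->
  (forall d xi, A (glue_vmetric d lam xi) ->
    exists e f, e <> f /\ B (d e) /\ C (d f)) ->
  P A <= 16%:R%:E * (P B * P C).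
Proof.
move=> cA cB cC ABC; have mB := cylindrical_measurable cB.
have mC := cylindrical_measurable cC.
rewrite -(P_stationary (cylindrical_measurable cA)) /PhiM /pushforward.
pose s := [:: e1; e2; e3; e4].
apply: (@measure_seq_le _ _ _ (law5 P m) _ (allpairs pair s s)
  (fun p => [set x | p.1 <> p.2 /\ B (pieces x p.1) /\ C (pieces x p.2)])).
- exact: cylindrical_glue.
- move=> [e f] /=; have [->|ef] := pselect (e = f).
    by rewrite (_ : [set x | _] = set0)//; apply/seteqP; split=> // x [].
  rewrite (_ : [set x | _] = (pieces^~ e @^-1` B) `&` (pieces^~ f @^-1` C)).
    by apply: measurableI; rewrite -[X in measurable X]setTI; exact: measurable_pieces.
  by apply/seteqP; split=> x /= => [[]|].
- by move=> p; exact: law5_piece2.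
- move=> x /=; rewrite glue_mapE => /ABC[e [f ef]]; exists (e, f) => //.
  by case: (e); case: (f).
Qed.

End stationary_bounds.

Section cylindrical_events.
Context {R : realType}.

Lemma cylindrical_geodesic w : cylindrical [set d : vmetric R | geodesic d w].
Proof.
apply: cylindrical_le; last exact: cylindrical_eval.
by repeat apply: cylindricalD; exact: cylindrical_eval.
Qed.

(** Some geodesic cell of depth [m] passes almost all its length on to a single
    cell [n] levels below. *)
Definition unbalanced (eps : R) (m n : nat) : set (vmetric R) :=
  [set d | exists u v, size u = m /\ size v = n /\ geodesic d (u ++ v) /\
    cell_length d u < (1 + eps) * cell_length d (u ++ v)].

Lemma cylindrical_unbalanced eps m n : cylindrical (unbalanced eps m n).
Proof.
apply: cylindrical_exists => u; apply: cylindrical_exists => v.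
  do 2 (apply: cylindrical_and; first exact: cylindrical_prop).
  apply: cylindrical_and; first exact: cylindrical_geodesic.
  apply: cylindrical_lt; first exact: cylindrical_eval.
  by apply: cylindricalM; [exact: cylindrical_cst|exact: cylindrical_eval].
Qed.

Definition atypical (K eps : R) : set (vmetric R) :=
  [set d | K <= d vI vO \/ d vI vO < eps * K].

Lemma cylindrical_atypical K eps : cylindrical (atypical K eps).
Proof.
apply: cylindrical_or.
  by apply: cylindrical_le; [exact: cylindrical_cst|exact: cylindrical_eval].
by apply: cylindrical_lt; [exact: cylindrical_eval|exact: cylindrical_cst].
Qed.

End cylindrical_events.

Section tameness.
Local Open Scope ereal_scope.
Context {R : realType} (lam : Rplus R) (m : probability (Rplus R) R).
Variable P : probability (vmetric R) R.
Hypothesis P_stationary : stationary lam m P.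

Lemma atypical_small (c : R) : (0 < c)%R ->
  exists K eps, (0 < eps)%R /\ P (atypical K eps) <= c%:E.
Proof.
move=> c0; have c20 : (0 < c / 2)%R by rewrite divr_gt0.
have cge (K : R) : cylindrical [set d : vmetric R | K <= d vI vO]%R.
  by apply: cylindrical_le; [exact: cylindrical_cst|exact: cylindrical_eval].
have clt (K : R) : cylindrical [set d : vmetric R | d vI vO < K]%R.
  by apply: cylindrical_lt; [exact: cylindrical_eval|exact: cylindrical_cst].
have [n Pn] : exists n, P [set d | n.+1%:R <= d vI vO]%R <= (c / 2)%:E.
  apply: (@measure_small _ _ _ P (fun n => [set d : vmetric R | n.+1%:R <= d vI vO]%R)) => // [n|n d /=|d].
  - exact: cylindrical_measurable.
  - by apply: le_trans; rewrite ler_nat.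
  - exists (truncn (d vI vO)) => /=; apply/negP; rewrite -ltNge; exact: truncnS_gt.
set K : R := n.+1%:R in Pn.
have K0 : (0 < K)%R by rewrite ltr0n.
have [k Pk] : exists k, P [set d | d vI vO < k.+1%:R^-1 * K]%R <= (c / 2)%:E.
  apply: (@measure_small _ _ _ P (fun k => [set d : vmetric R | d vI vO < k.+1%:R^-1 * K]%R)) => // [k|k d /=|d].
  - exact: cylindrical_measurable.
  - move=> h; apply: lt_le_trans h _; rewrite ler_pM2r// lef_pV2 ?posrE ?ltr0n//.
    by rewrite ler_nat.
  - have d0 : (0 < d vI vO)%R by apply: vdist_gt0.
    exists (truncn (K / d vI vO)) => /=; apply/negP; rewrite -leNgt mulrC.
    by rewrite ler_pdivrMr ?ltr0n// -ler_pdivrMl// mulrC ltW// truncnS_gt.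
exists K, (k.+1%:R^-1)%R; split; first by rewrite invr_gt0 ltr0n.
rewrite (splitr c) EFinD; apply: (le_trans _ (leeD Pn Pk)).
exact: (measureU2 P (cylindrical_measurable (cge K))
  (cylindrical_measurable (clt (k.+1%:R^-1 * K)%R))).
Qed.

(** A threshold [K] turns the comparison with the length of the piece [e] into a
    condition on another piece alone: if [e] is longer than [K], so is the
    parallel piece; if not, some piece in series with [e] is shorter than
    [eps * K]. *)
Lemma unbalanced_root_step K eps n : (0 < eps)%R ->
  P (unbalanced eps 0 n.+1) <= 16%:R%:E * (P (unbalanced eps 0 n) * P (atypical K eps)).
Proof.
move=> eps0; apply: (stationary_le2 P_stationary).
- exact: cylindrical_unbalanced.
- exact: cylindrical_unbalanced.
- exact: cylindrical_atypical.
move=> d xi [u [[|e w] [/size0nil -> []]]] // [sw] [gw lw].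
have [lew [f fe lf]] := dominant_cell_glue gw lw.
have [se gew] := (geodesic_glue _ _ _ _ _).1 gw.
have Be : unbalanced eps 0 n (d e) by exists [::], w.
have [Ke|Ke] := leP K (d e vI vO).
  exists e, (partner e); split; first by case: (e).
  by split=> //; left; exact: le_trans Ke se.
exists e, f; split; first by move=> ef; move: fe; rewrite ef; case: (front f).
split=> //; right; apply: lt_le_trans lf _.
by rewrite ler_pM2l// ltW.
Qed.

End tameness.

(** * Almost every metric is tame *)

Section tame_almost_surely.
Local Open Scope ereal_scope.
Context {R : realType} (lam : Rplus R) (m : probability (Rplus R) R).
Variable P : probability (vmetric R) R.
Hypothesis P_stationary : stationary lam m P.

(** [32] is twice the constant [16] of the recursion, so each level halves the
    bound. *)
Lemma unbalanced_root_le K eps n : (0 < eps)%R ->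
  P (atypical K eps) <= (32%:R^-1)%:E ->
  P (unbalanced eps 0 n) <= ((2%:R^-1) ^+ n)%:E.
Proof.
move=> eps0 small; elim: n => [|n IH].
  by rewrite expr0 probability_le1//; exact: cylindrical_measurable (@cylindrical_unbalanced _ _ _ _).
apply: le_trans (unbalanced_root_step P_stationary K n eps0) _.
apply: le_trans (lee_wpmul2l _ (lee_pmul _ _ IH small)) _ => //.
rewrite -!EFinM lee_fin exprS; have : (0 <= (2%:R^-1) ^+ n :> R)%R.
  by rewrite exprn_ge0// invr_ge0.
by move: (_ ^+ n)%R => x; lra.
Qed.

(** A cell of depth [k] is the root of one of [4 ^ k] pieces; this factor is beaten
    by taking [n] large, since [k] is fixed. *)
Lemma unbalanced_le K eps k n : (0 < eps)%R ->
  P (atypical K eps) <= (32%:R^-1)%:E ->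
  P (unbalanced eps k n) <= (4%:R ^+ k * (2%:R^-1) ^+ n)%:E.
Proof.
move=> eps0 small; elim: k => [|k IH].
  by rewrite expr0 mul1r; exact: unbalanced_root_le small.
have : P (unbalanced eps k.+1 n) <= 4%:R%:E * P (unbalanced eps k n).
  apply: (stationary_le1 P_stationary); [exact: cylindrical_unbalanced..|].
  move=> d xi [[|e u] [v [] // [su] [sv [guv luv]]]].
  have [se gev] := (geodesic_glue _ _ _ _ _).1 guv.
  exists e, u, v; do 3 split=> //.
  move: luv; rewrite cat_cons !cell_length_glue// mulrCA ltr_pM2l//.
  by rewrite mulr_gt0// rval_gt0.
move=> /le_trans; apply; rewrite exprS -mulrA EFinM.
by apply: lee_wpmul2l; rewrite ?lee_fin.
Qed.

Lemma unbalanced_null : exists2 eps : R, (0 < eps)%R &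
  forall k, P [set d | forall n, unbalanced eps k n d] = 0.
Proof.
have c0 : (0 < 32%:R^-1 :> R)%R by rewrite invr_gt0.
have [K [eps [eps0 small]]] := atypical_small P c0; exists eps => // k.
apply: measure_vanishes => i; set N := (4 ^ k * i.+1)%N.
have : P [set d | forall n, unbalanced eps k n d] <= P (unbalanced eps k N).
  apply: le_measure; rewrite ?inE; last by move=> d /(_ N).
  - apply: cylindrical_measurable; apply: cylindrical_forall => n.
    exact: cylindrical_unbalanced.
  - by apply: cylindrical_measurable; exact: cylindrical_unbalanced.
move=> /le_trans; apply; apply: le_trans (unbalanced_le k N eps0 small) _.
rewrite lee_fin exprVn ler_pdivrMr ?exprn_gt0// mulrC ler_pdivlMr ?ltr0n//.
by rewrite -!natrX -natrM ler_nat ltnW// ltn_expl.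
Qed.

Lemma geodesic_root_null : P [set d | ~ geodesic d [::]] = 0.
Proof.
apply: (stationary_null P_stationary (B := set0)) => //.
- exact: cylindricalC (@cylindrical_geodesic _ _).
- exact: cylindrical_prop.
- by move=> d xi /= []; exact: geodesic_glue_root.
Qed.

(** A geodesic cell in which no shortest path continues through the half indicated
    by [b]. *)
Definition barren (w : seq edge) (b : bool) : set (vmetric R) :=
  [set d | geodesic d w /\ ~ exists e, front e = b /\ geodesic d (rcons w e)].

Lemma cylindrical_barren w b : cylindrical (barren w b).
Proof.
apply: cylindrical_and; first exact: cylindrical_geodesic.
apply: (@cylindricalC _ [set d | exists e, front e = b /\ geodesic d (rcons w e)]).
apply: cylindrical_exists => e; apply: cylindrical_and.
  exact: cylindrical_prop.
exact: cylindrical_geodesic.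
Qed.

Lemma barren_null w b : P (barren w b) = 0.
Proof.
elim: w => [|e w IH].
  apply: (stationary_null P_stationary _ _ _ geodesic_root_null).
  - exact: cylindrical_barren.
  - exact: cylindricalC (@cylindrical_geodesic _ _).
  move=> d xi [_ nochild]; have [e eb se] := shortest_exists d b.
  exists e => /= ge; apply: nochild; exists e; split=> //.
  exact/geodesic_glue.
apply: (stationary_null P_stationary _ _ _ IH); [exact: cylindrical_barren..|].
move=> d xi [/geodesic_glue[se ge] nochild]; exists e; split=> // -[f [fb gf]].
by apply: nochild; exists f; split=> //=; exact/geodesic_glue.
Qed.

Lemma tame_almost_surely : exists2 eps : R, (0 < eps)%R &
  cylindrical (tame eps) /\ P (~` tame eps) = 0.
Proof.
have [eps eps0 unull] := unbalanced_null; exists eps => //.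
have tameE : tame eps = [set d | geodesic d [::] /\
    (forall p : seq edge * bool, ~ barren p.1 p.2 d) /\
    (forall k, ~ forall n, unbalanced eps k n d)].
  apply/seteqP; split=> d.
    move=> [gr gc gs]; split=> //; split=> [[w b] [/= gw]|k uk].
      by apply; have [e eb ge] := gc w b gw; exists e.
    have [n nP] := gs k; have [u [v [su [sv [guv]]]]] := uk n.
    by rewrite ltNge nP.
  move=> [gr [gc gs]]; split=> // [w b gw|k].
    apply: contrapT => nochild; apply: (gc (w, b)); split=> // -[e [eb ge]].
    by apply: nochild; exists e.
  have /existsNP[n nP] := gs k; exists n => u v su sv guv.
  by rewrite leNgt; apply/negP => luv; apply: nP; exists u, v.
have ctame : cylindrical (tame eps).
  rewrite tameE; apply: cylindrical_and; first exact: cylindrical_geodesic.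
  apply: cylindrical_and.
    by apply: cylindrical_forall => p; apply: cylindricalC; exact: cylindrical_barren.
  apply: cylindrical_forall => k.
  apply: (@cylindricalC _ [set d | forall n, unbalanced eps k n d]).
  by apply: cylindrical_forall => n; exact: cylindrical_unbalanced.
split=> //; apply/(negligibleP P).
  exact: cylindrical_measurable (cylindricalC ctame).
have n1 : P.-negligible [set d | ~ geodesic d [::]].
  apply/(negligibleP P); last exact: geodesic_root_null.
  exact: cylindrical_measurable (cylindricalC (@cylindrical_geodesic _ _)).
have n2 : P.-negligible [set d | exists p : seq edge * bool, barren p.1 p.2 d].
  apply: (@negligible_exists _ _ _ _ _ (fun p => barren p.1 p.2)) => p.
    exact: cylindrical_measurable (@cylindrical_barren _ _).
  exact: barren_null.
have n3 : P.-negligible [set d | exists k, forall n, unbalanced eps k n d].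
  apply: (@negligible_exists _ _ _ _ _ (fun k => [set d | forall n, unbalanced eps k n d])).
    move=> k; apply: cylindrical_measurable; apply: cylindrical_forall => n.
    exact: cylindrical_unbalanced.
  exact: unull.
apply: negligibleS (negligibleU n1 (negligibleU n2 n3)) => d /=.
apply: contra_notP => /not_orP[/contrapT gr /not_orP[/forallNP gc /forallNP gs]].
by rewrite tameE.
Qed.

End tame_almost_surely.

(** * From the root to all cells *)

Definition cell_copy (w : seq edge) (x : vertex) : vertex := foldr copy x w.

Lemma ends_cell_copy w : ends w = (cell_copy w vI, cell_copy w vO).
Proof. by elim: w => //= e w ->. Qed.

(** On the cell [w], the metric [d] is a Lipschitz image of a metric from [K].  With
    [K] compact this replaces the statement that the piece at [w] belongs to
    [K], which is not a condition on [d] since shortcuts lose information on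
    the piece. *)
Definition dominated (R : realType) (w : seq edge) (b : R) (K : set (vmetric R)) :
    set (vmetric R) :=
  [set d | exists2 d', K d' &
    forall x y, d (cell_copy w x) (cell_copy w y) <= b * d' x y].

(** Every vertex [vM w] is an end point of the cell [rcons w e1], whose other end
    point belongs to a coarser cell. *)
Lemma dominated_connected (R : realType) (eps : R) (d : vmetric R) : 0 < eps ->
  (forall w, exists2 b, 0 <= b & dominated w b (tame eps) d) ->
  connected_completion d.
Proof.
move=> eps0 dom X iota [Xc iso dns].
have cell (U : set X) w : open U -> closed U ->
    U (iota (ends w).1) <-> U (iota (ends w).2).
  suff half (V : set X) : open V -> closed V ->
      V (iota (ends w).1) -> V (iota (ends w).2).
    move=> oU cU; split; first exact: half.
    move=> U2; apply: contrapT => U1.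
    exact: (half (~` U) (closed_openC cU) (open_closedC oU) U1).
  move=> oV cV; rewrite ends_cell_copy /=.
  have [b b0 [d' td' dd']] := dom w.
  apply: (tame_not_separated (j := fun x => iota (cell_copy w x)) eps0 td' Xc b0) => //.
  by move=> x y; rewrite iso.
have all_vertices (U : set X) : open U -> closed U ->
    forall x, U (iota vI) <-> U (iota x).
  move=> oU cU.
  have both w : (U (iota vI) <-> U (iota (ends w).1)) /\
                (U (iota vI) <-> U (iota (ends w).2)).
    elim/last_ind: w => [|w e [I1 I2]]; first by split=> //; exact: (cell U [::] oU cU).
    have M : U (iota vI) <-> U (iota (vM w)).
      by apply: (iff_trans I1); have := cell U (rcons w e1) oU cU; rewrite ends_rcons.
    by rewrite ends_rcons; case: e.
  case=> [//||w]; first by have [_] := both [::].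
  by have [_] := both (rcons w e1); rewrite ends_rcons.
move=> B [p Bp] [U oU BU] [V cV BV].
have oB : open B by rewrite BU setTI.
have cB : closed B by rewrite BV setTI.
apply/seteqP; split=> // q _; apply: contrapT => Bq.
have [p' [Bx [x _ xE]]] := dns B (ex_intro _ p Bp) oB.
have [q' [By [y _ yE]]] := dns (~` B) (ex_intro _ q Bq) (closed_openC cB).
apply: By; rewrite -yE; apply/(all_vertices B oB cB y)/(all_vertices B oB cB x).
by rewrite xE.
Qed.

Section compact_domination.
Context {R : realType}.

(** For compact [K], finitely many strict inequalities suffice to separate [d] from
    everything that [K] dominates; they can be taken with rational thresholds,
    which leaves countably many possibilities. *)
Lemma cylindrical_not_dominated w (b : R) (K : set (vmetric R)) : compact K ->
  cylindrical (~` dominated w b K).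
Proof.
move=> cK; pose slack := (vertex * vertex * rat)%type.
pose below (t : slack) := [set d : vmetric R | b * d t.1.1 t.1.2 < ratr t.2].
pose above (t : slack) := [set d : vmetric R |
  ratr t.2 <= d (cell_copy w t.1.1) (cell_copy w t.1.2)].
rewrite (_ : ~` _ = [set d | exists s : seq slack,
    (K `<=` [set d' | exists2 t, t \in s & below t d']) /\
    (forall t, t \in s -> above t d)]).
  apply: cylindrical_exists => s; apply: cylindrical_and.
    exact: cylindrical_prop.
  apply: cylindrical_forall => t; apply: cylindrical_imply.
    exact: cylindrical_prop.
  by apply: cylindrical_le; [exact: cylindrical_cst|exact: cylindrical_eval].
apply/seteqP; split=> d; last first.
  move=> [s [Ks sd]] [d' /Ks[t ts lt] dd'].
  have := sd t ts; rewrite /above /= => le.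
  by have := le_lt_trans (le_trans le (dd' _ _)) lt; rewrite ltxx.
move=> nd; pose D : set slack := [set t | above t d].
have oB t : D t -> open (below t).
  move=> _; rewrite (_ : below t =
      (fun d' : vmetric R => b * d' t.1.1 t.1.2) @^-1` [set` `]-oo, ratr t.2[]).
    apply: open_comp; last exact: interval_open.
    move=> d' _; apply: (@continuous_comp _ _ _
      (fun d' : vmetric R => d' t.1.1 t.1.2) (fun r : R => b * r)).
      exact: continuous_eval.
    exact: mulrl_continuous.
  by apply/seteqP; split=> d' /=; rewrite in_itv.
have KB : K `<=` cover D below.
  move=> d' Kd'; apply: contrapT => nc; apply: nd; exists d' => // x y.
  rewrite leNgt; apply/negP => /rat_in_itvoo[q]; rewrite in_itv /= => /andP[q1 q2].
  by apply: nc; exists (x, y, q) => //; exact: ltW.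
move: cK; rewrite compact_cover => /(_ _ D below oB KB)[s sD sK].
exists (finmap.enum_fset s); split=> [d' /sK[t ts bt]|t ts]; first by exists t.
exact: set_mem (sD t ts).
Qed.

Variables (lam : Rplus R) (m : probability (Rplus R) R).
Variable P : probability (vmetric R) R.
Hypothesis P_stationary : stationary lam m P.

(** Gluing is Lipschitz on each piece, so domination of [d e] on the cell [w]
    passes to the glued metric on the cell [e :: w]. *)
Lemma undominated_null (K : nat -> set (vmetric R)) :
  (forall n, compact (K n)) -> (forall n, (P (~` K n) <= (n.+1%:R^-1)%:E)%E) ->
  forall w, P (\bigcap_i \bigcap_n ~` dominated w (i%:R : R) (K n)) = 0%E.
Proof.
move=> cK PK.
have cN w : cylindrical (\bigcap_i \bigcap_n ~` dominated w (i%:R : R) (K n)).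
  rewrite (_ : \bigcap_i _ =
      [set d | forall i n, (~` dominated w (i%:R : R) (K n)) d]); last first.
    by apply/seteqP; split=> d H i; [move=> n; exact: H|move=> _ n _; exact: H].
  apply: cylindrical_forall => i; apply: cylindrical_forall => n.
  exact: cylindrical_not_dominated.
elim=> [|e w IH].
  apply: measure_vanishes => n; apply: le_trans (PK n); apply: le_measure; rewrite ?inE.
  - exact: cylindrical_measurable.
  - apply: measurableC; rewrite -[K n]setCK; apply: measurableC.
    apply: vmetric_open_measurable; apply: closed_openC.
    exact: compact_closed vmetric_hausdorff (cK n).
  - move=> d nd Kd; apply: (nd 1%N I n I); exists d => // x y.
    by rewrite mul1r.
apply: (stationary_null P_stationary _ _ _ IH) => // d xi nd.
exists e => i _ n _ [d' Kd' dd'].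
have k0 : 0 < rval lam * rval xi by rewrite mulr_gt0 ?rval_gt0.
set b : R := rval lam * rval xi * i%:R.
apply: (nd (truncn b).+1 I n I); exists d' => // x y.
apply: le_trans (glue_vmetric_copy_le _ _ _ _ _ _) _.
apply: (@le_trans _ _ (b * d' x y)); first by rewrite /b -[leRHS]mulrA ler_pM2l//; exact: dd'.
by rewrite ler_wpM2r ?vdist_ge0// ltW// truncnS_gt.
Qed.

Lemma stationary_connected : radon P ->
  {ae P, forall d : vmetric R, connected_completion d}.
Proof.
move=> radonP; have [eps eps0 [ctame Ptame]] := tame_almost_surely P_stationary.
have Ptame1 : P (tame eps) = 1%E.
  rewrite -(setCK (tame eps)) probability_setC; last first.
    exact: cylindrical_measurable (cylindricalC ctame).
  by rewrite Ptame sube0.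
have /choice[K HK] : forall n, exists K : set (vmetric R),
    [/\ compact K, K `<=` tame eps & (P (~` K) <= (n.+1%:R^-1)%:E)%E].
  move=> n.
  have n0 : 0 < n.+1%:R^-1 :> R by rewrite invr_gt0 ltr0n.
  have radontame := radonP _ (cylindrical_measurable ctame).
  have [|_ [K [cK Ktame] <-]] := @ub_ereal_sup_adherent _
    [set P K | K in [set K | compact K /\ K `<=` tame eps]] _ n0.
    by rewrite -radontame Ptame1.
  rewrite -radontame Ptame1 => PK; exists K; split=> //.
  have mK : measurable K.
    rewrite -[K]setCK; apply: measurableC; apply: vmetric_open_measurable.
    apply: closed_openC; exact: compact_closed vmetric_hausdorff cK.
  rewrite probability_setC// leeBlDr ?fin_num_measure// addeC -leeBlDr// ?ltW//.
have cK n : compact (K n) by have [] := HK n.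
have PK n : (P (~` K n) <= (n.+1%:R^-1)%:E)%E by have [] := HK n.
pose N w := \bigcap_i \bigcap_n ~` dominated w (i%:R : R) (K n).
have mN w : measurable (N w).
  apply: bigcapT_measurable => i; apply: bigcapT_measurable => n.
  by apply: cylindrical_measurable; exact: cylindrical_not_dominated.
apply: negligibleS (negligible_exists mN (undominated_null cK PK)) => d.
apply: contra_notP => /forallNP dN; apply: (dominated_connected eps0) => w.
have /existsNP[i /not_implyP[_ /existsNP[n /not_implyP[_ /contrapT[d' Kd' dd']]]]] := dN w.
exists i%:R => //; exists d' => //; have [_ + _] := HK n; exact.
Qed.

End compact_domination.

Theorem theorem4 (R : realType) (sigma : R) (sigma_gt0 : 0 < sigma)
  (A : R) (A_gt0 : 0 < A)
  (lambda_cr : Rplus R)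
  (lambda_crE : rval lambda_cr = critical_constant A (lognormal sigma))
  (mbar : probability (vmetric R) R) (mbar_radon : radon mbar)
  (mbar_non_atomic : non_atomic mbar)
  (mbar_stationary : stationary lambda_cr (lognormal sigma) mbar) :
  {ae mbar, forall d : vmetric R, connected_completion d}.
Proof. exact: stationary_connected mbar_stationary mbar_radon. Qed.
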